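(* A tetrahedron of type (g), (p), (w) or (y) does not tile $\mathbb{R}^3$ face-to-face.
   Context: For a nondegenerate tetrahedron $V_1V_2V_3V_4$ in $\mathbb{R}^3$, let $d_{ij}$ be the length of the edge $e_{ij}$ joining $V_i$ and $V_j$. A tetrahedron is of a given type if, after some permutation of its vertices, the sextuple $(d_{12},d_{13},d_{14},d_{23},d_{24},d_{34})$ has the listed pattern, where different letters stand for different lengths: (g) $(a,b,c,c,b,a)$; (p) $(a,c,b,b,d,a)$; (w) $(b,a,c,d,a,e)$; (y) $(a,b,c,d,e,f)$. A tetrahedron $T$ tiles $\mathbb{R}^3$ face-to-face if $\mathbb{R}^3$ is the union of congruent copies of $T$ (images of $T$ under isometries of $\mathbb{R}^3$, orientation-reversing isometries being allowed) with pairwise disjoint interiors such that any two copies intersect in the empty set, a common vertex, a common edge, or a common face. *)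

(* Defs.v *)
From mathcomp Require Import all_boot all_order all_algebra all_fingroup.
From mathcomp Require Import all_classical all_reals all_analysis.
Import Order.TTheory GRing.Theory Num.Theory.
Import numFieldNormedType.Exports.

Set Implicit Arguments.
Unset Strict Implicit.
Unset Printing Implicit Defensive.

Local Open Scope classical_set_scope.
Local Open Scope ring_scope.

(* Points of R^3 are row vectors. The library norm on 'rV[R]_3 is the sup norm,
   so the Euclidean distance is defined here; both induce the same topology,
   hence the library's [interior] is the usual one. *)
Definition eucl_dist (R : realType) (x y : 'rV[R]_3) : R :=
  Num.sqrt (\sum_(i < 3) (x 0 i - y 0 i) ^+ 2).

(* Orientation-reversing maps are included. *)
Definition is_isometry (R : realType) (f : 'rV[R]_3 -> 'rV[R]_3) : Prop :=
  forall x y, eucl_dist (f x) (f y) = eucl_dist x y.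

(* The vertices V_1, ..., V_4 are V 0, ..., V 3. *)
Definition nondegenerate_tetrahedron (R : realType)
    (V : 'I_4 -> 'rV[R]_3) : Prop :=
  row_free (\matrix_(i < 3) (V (lift ord0 i) - V ord0)).

Definition edge_lengths (R : realType) (V : 'I_4 -> 'rV[R]_3) : seq R :=
  [:: eucl_dist (V 0) (V 1); eucl_dist (V 0) (V 2); eucl_dist (V 0) (V 3);
      eucl_dist (V 1) (V 2); eucl_dist (V 1) (V 3); eucl_dist (V 2) (V 3)].

Definition type_g (R : realType) (V : 'I_4 -> 'rV[R]_3) : Prop :=
  exists (s : 'S_4) (a b c : R),
    uniq [:: a; b; c] /\ edge_lengths (V \o s) = [:: a; b; c; c; b; a].

Definition type_p (R : realType) (V : 'I_4 -> 'rV[R]_3) : Prop :=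
  exists (s : 'S_4) (a b c d : R),
    uniq [:: a; b; c; d] /\ edge_lengths (V \o s) = [:: a; c; b; b; d; a].

Definition type_w (R : realType) (V : 'I_4 -> 'rV[R]_3) : Prop :=
  exists (s : 'S_4) (a b c d e : R),
    uniq [:: a; b; c; d; e] /\ edge_lengths (V \o s) = [:: b; a; c; d; a; e].

Definition type_y (R : realType) (V : 'I_4 -> 'rV[R]_3) : Prop :=
  exists (s : 'S_4) (a b c d e f : R),
    uniq [:: a; b; c; d; e; f] /\
    edge_lengths (V \o s) = [:: a; b; c; d; e; f].

(* Convex hull of the vertices V i, i \in J. *)
Definition hull (R : realType) (V : 'I_4 -> 'rV[R]_3) (J : {set 'I_4}) :
    set 'rV[R]_3 :=
  [set x | exists w : 'I_4 -> R,
     [/\ forall i, 0 <= w i, forall i, i \notin J -> w i = 0,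
         \sum_i w i = 1 & x = \sum_i w i *: V i]].

Definition tetrahedron (R : realType) (V : 'I_4 -> 'rV[R]_3) : set 'rV[R]_3 :=
  hull V [set: 'I_4].

(* S is the hull of k vertices of the copy f @` tetrahedron V: a vertex (as a
   singleton), an edge or a face of it for k = 1, 2, 3 respectively. *)
Definition is_face (R : realType) (V : 'I_4 -> 'rV[R]_3)
    (f : 'rV[R]_3 -> 'rV[R]_3) (k : nat) (S : set 'rV[R]_3) : Prop :=
  exists2 J : {set 'I_4}, #|J| = k & S = f @` hull V J.

(* The copies are given by a set F of isometries. Since tetrahedron V has
   nonempty interior, disjointness of interiors forces distinct elements of F
   to give distinct copies. *)
Definition tiles_face_to_face (R : realType) (V : 'I_4 -> 'rV[R]_3) : Prop :=
  exists F : set ('rV[R]_3 -> 'rV[R]_3),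
  [/\ forall f, F f -> is_isometry f,
      \bigcup_(f in F) (f @` tetrahedron V) = [set: 'rV[R]_3],
      forall f g, F f -> F g -> f <> g ->
        interior (f @` tetrahedron V) `&` interior (g @` tetrahedron V) = set0
    & forall f g, F f -> F g -> f <> g ->
        let S := (f @` tetrahedron V) `&` (g @` tetrahedron V) in
        S = set0 \/
        exists2 k : nat, (1 <= k <= 3)%N & is_face V f k S /\ is_face V g k S].

(* Main.v *)
(* All four types have two properties: two edges with a common endpoint have
   different lengths, and an isometry between two faces extends to a symmetry of
   the tetrahedron. By the second one, the copy adjacent to a given copy across a
   face is its mirror image in that face. Reflecting repeatedly around an edge
   with dihedral angle t produces copies filling the sectors [n t, (n + 1) t] and
   [- (n + 1) t, - n t] around it; if n t < pi < (n + 1) t two of these overlap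
   without coinciding, so t = pi / n for some n >= 2. Hence, with x_i the face
   areas and c_ij the cosines of the dihedral angles, x_i = sum_j c_ij x_j where
   c_ij = cos (pi / n_ij). As in the classification of Coxeter tetrahedra, this
   leaves few possibilities, and all of them have two edges of the same length
   with a common endpoint. *)

Require Import Defs.
From mathcomp Require Import all_boot all_order all_algebra.
From mathcomp Require Import all_fingroup.
From mathcomp Require Import all_classical all_reals all_analysis.
From mathcomp Require Import ring lra.
Import Order.TTheory GRing.Theory Num.Theory.
Import numFieldNormedType.Exports.

Set Implicit Arguments.
Unset Strict Implicit.
Unset Printing Implicit Defensive.

Local Open Scope classical_set_scope.
Local Open Scope ring_scope.

(** * Euclidean space and barycentric coordinates *)

Section Dot.
Context {R : realType}.
Implicit Types (u v x y z : 'rV[R]_3) (X Y Z g : 'I_4 -> 'rV[R]_3).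

(** A tetrahedron is handled through the gradients of its barycentric coordinates. Each gradient is
    normal to a face and its length is the inverse of the height on that face, so the gradient
    lengths are proportional to the face areas; since the gradients sum to 0, the relation between
    areas and cosines follows. The two copies that straddle the angle pi are mirror images of each
    other. They cannot coincide: the reflection would exchange the two vertices off the edge and
    make two edges with a common endpoint equal. The obstacle before any reflection is that a
    covering by an arbitrary family of copies says nothing directly about faces. A neighbour is
    obtained as a limit, from copies that contain points approaching the face from outside, using
    local finiteness, which comes from the disjointness of the interiors of congruent copies. The
    diagrams left at the end are those of the affine Coxeter groups of types A3, B3 and C3: a cycle,
    a star and a path. *)

Definition dot u v : R := \sum_(i < 3) u 0 i * v 0 i.

Lemma dotC u v : dot u v = dot v u.
Proof. by apply: eq_bigr => i _; rewrite mulrC. Qed.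

Lemma dotDl u v x : dot (u + v) x = dot u x + dot v x.
Proof. by rewrite -big_split; apply: eq_bigr => i _; rewrite mxE mulrDl. Qed.

Lemma dotZl a u x : dot (a *: u) x = a * dot u x.
Proof. by rewrite big_distrr /=; apply: eq_bigr => i _; rewrite mxE mulrA. Qed.

Lemma dotNl u x : dot (- u) x = - dot u x.
Proof. by rewrite -scaleN1r dotZl mulN1r. Qed.

Lemma dotDr u v x : dot x (u + v) = dot x u + dot x v.
Proof. by rewrite dotC dotDl !(dotC x). Qed.

Lemma dotZr a u x : dot x (a *: u) = a * dot x u.
Proof. by rewrite dotC dotZl (dotC x). Qed.

Lemma dotNr u x : dot x (- u) = - dot x u.
Proof. by rewrite dotC dotNl (dotC x). Qed.

Lemma dot0l x : dot 0 x = 0.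
Proof. by rewrite -(scale0r 0) dotZl mul0r. Qed.

Lemma dot0r x : dot x 0 = 0.
Proof. by rewrite dotC dot0l. Qed.

Definition dotE := (dotDl, dotDr, dotNl, dotNr, dotZl, dotZr, dot0l, dot0r).

Lemma dot_suml (I : Type) (r : seq I) (P : pred I) (F : I -> 'rV[R]_3) x :
  dot (\sum_(i <- r | P i) F i) x = \sum_(i <- r | P i) dot (F i) x.
Proof.
exact: (big_morph (fun u => dot u x) (fun u v => dotDl u v x) (dot0l x)).
Qed.

Lemma dot_sumr (I : Type) (r : seq I) (P : pred I) (F : I -> 'rV[R]_3) x :
  dot x (\sum_(i <- r | P i) F i) = \sum_(i <- r | P i) dot x (F i).
Proof. by rewrite dotC dot_suml; apply: eq_bigr => i _; rewrite dotC. Qed.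

Lemma dot_ge0 x : 0 <= dot x x.
Proof. by apply: sumr_ge0 => i _; rewrite -expr2 sqr_ge0. Qed.

Lemma dot_eq0 x : (dot x x == 0) = (x == 0).
Proof.
apply/idP/eqP => [|->]; last by rewrite dot0l.
rewrite psumr_eq0 => [/allP x0|i _]; last by rewrite -expr2 sqr_ge0.
apply/rowP => i; rewrite mxE; apply/eqP.
by have := x0 i (mem_index_enum i); rewrite -expr2 sqrf_eq0.
Qed.

Lemma dot_gt0 x : (0 < dot x x) = (x != 0).
Proof. by rewrite lt_neqAle dot_ge0 andbT eq_sym dot_eq0. Qed.

Definition sqd x y : R := dot (x - y) (x - y).

Lemma sqdC x y : sqd x y = sqd y x.
Proof. by rewrite /sqd !dotE; ring. Qed.

Lemma sqd_ge0 x y : 0 <= sqd x y.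
Proof. exact: dot_ge0. Qed.

Lemma eucl_dist_sqd x y : eucl_dist x y = Num.sqrt (sqd x y).
Proof.
by congr Num.sqrt; apply: eq_bigr => i _; rewrite !mxE expr2.
Qed.

Lemma eucl_dist_inj x y x' y' :
  eucl_dist x y = eucl_dist x' y' -> sqd x y = sqd x' y'.
Proof.
rewrite !eucl_dist_sqd => /(congr1 (fun a => a ^+ 2)).
by rewrite !sqr_sqrtr ?sqd_ge0.
Qed.

Lemma polarization x y z :
  dot (x - z) (y - z) = (sqd x z + sqd y z - sqd x y) / 2.
Proof.
by apply: (@mulIf _ 2) => //; rewrite divfK // /sqd !dotE (dotC y x) (dotC z x) (dotC z y); ring.
Qed.

Definition congruent X Y := forall i j, sqd (X i) (X j) = sqd (Y i) (Y j).

(* [e i + dot (g i) x] is the i-th barycentric coordinate of [x] with respect to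
   [X], and [g i] is its gradient. *)
Definition bary_frame X (e : 'I_4 -> R) g : Prop :=
  [/\ forall x, \sum_i (e i + dot (g i) x) = 1,
      forall x, \sum_i (e i + dot (g i) x) *: X i = x
    & forall i j, e i + dot (g i) (X j) = (i == j)%:R].

Lemma sum_affine (w : 'I_4 -> R) (e : R) v X :
  \sum_i w i = 1 -> e + dot v (\sum_i w i *: X i) = \sum_i w i * (e + dot v (X i)).
Proof.
move=> w1; rewrite dot_sumr -[X in X + _]mul1r -w1 mulr_suml -big_split.
by apply: eq_bigr => i _; rewrite dotZr mulrDr.
Qed.

Lemma dot_lincomb (w : 'I_4 -> R) X :
  dot (\sum_i w i *: X i) (\sum_i w i *: X i) =
  \sum_i \sum_j w i * w j * dot (X i) (X j).
Proof.
rewrite dot_suml; apply: eq_bigr => i _; rewrite dotZl dot_sumr mulr_sumr.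
by apply: eq_bigr => j _; rewrite dotZr mulrA.
Qed.

(** By polarization, the squared norm of the combination depends only on mutual distances. This
    carries affine relations through an isometry before it is known to be affine. *)
Lemma congruent_lincomb (w : 'I_4 -> R) X Y a b :
  congruent X Y -> (forall i, sqd (X i) a = sqd (Y i) b) ->
  \sum_i w i *: (X i - a) = 0 -> \sum_i w i *: (Y i - b) = 0.
Proof.
move=> XY Xa X0; apply/eqP; rewrite -dot_eq0 dot_lincomb.
suff -> : \sum_i \sum_j w i * w j * dot (Y i - b) (Y j - b) =
  \sum_i \sum_j w i * w j * dot (X i - a) (X j - a).
  by rewrite -dot_lincomb X0 dot0l.
by do 2!apply: eq_bigr => ? _; rewrite !polarization !Xa XY.
Qed.

Lemma nondegenerate_lincomb X :
  nondegenerate_tetrahedron X <->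
  forall w : 'I_4 -> R, \sum_i w i *: (X i - X ord0) = 0 ->
    forall i, i != ord0 -> w i = 0.
Proof.
split=> [free w w0 i|free].
  case: (unliftP ord0 i) => [j ->|->]; last by rewrite eqxx.
  move=> _; pose v : 'rV_3 := \row_j w (lift ord0 j).
  suff : v = 0 by move=> /rowP /(_ j); rewrite !mxE.
  apply: (row_free_inj free); rewrite mul0mx mulmx_sum_row -[RHS]w0.
  rewrite [RHS]big_ord_recl subrr scaler0 add0r.
  by apply: eq_bigr => k _; rewrite mxE rowK.
apply: inj_row_free => v v0; apply/rowP => j; rewrite mxE.
pose w i := if unlift ord0 i is Some k then v 0 k else 0.
suff /free /(_ (lift ord0 j)) : \sum_i w i *: (X i - X ord0) = 0.
  by rewrite /w liftK; apply.
rewrite -[RHS]v0 mulmx_sum_row big_ord_recl subrr scaler0 add0r.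
by apply: eq_bigr => k _; rewrite /w liftK rowK.
Qed.

Lemma congruent_nondegenerate X Y :
  congruent X Y -> nondegenerate_tetrahedron X -> nondegenerate_tetrahedron Y.
Proof.
move=> XY /nondegenerate_lincomb X0; apply/nondegenerate_lincomb => w Y0.
apply: X0; apply: congruent_lincomb Y0 => [i j|i]; exact/esym/XY.
Qed.

Lemma bary_frame_exists X :
  nondegenerate_tetrahedron X -> exists e g, bary_frame X e g.
Proof.
move=> nd; pose A := \matrix_(i < 3) (X (lift ord0 i) - X ord0).
have uA : A \in unitmx by rewrite -row_free_unit.
pose B := invmx A.
(* The columns of [B] form the basis dual to the edge vectors at [X ord0]; the gradient at [ord0] is
   chosen so that the coordinates sum to 1. *)
pose g i := if unlift ord0 i is Some j then (col j B)^T
            else - \sum_j (col j B)^T.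
pose e i : R := (i == ord0)%:R - dot (g i) (X ord0).
have eg i x : e i + dot (g i) x = (i == ord0)%:R + dot (g i) (x - X ord0).
  by rewrite /e !dotE; ring.
have g_sum : \sum_i g i = 0.
  rewrite big_ord_recl {1}/g unlift_none.
  by under [X in _ + X]eq_bigr => i _ do rewrite /g liftK; rewrite addNr.
have sum1 x : \sum_i (e i + dot (g i) x) = 1.
  under eq_bigr => i _ do rewrite eg.
  rewrite big_split /= -dot_suml g_sum dot0l addr0 big_ord_recl eqxx.
  by rewrite big1 ?addr0.
have sumX x : \sum_i (e i + dot (g i) x) *: X i = x.
  rewrite -[RHS](subrK (X ord0)) -[X in _ + X]scale1r -(sum1 x) scaler_suml.
  apply/eqP; rewrite -subr_eq -sumrB; apply/eqP.
  under eq_bigr => i _ do rewrite -scalerBr.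
  rewrite big_ord_recl subrr scaler0 add0r.
  rewrite -[RHS](mulmxKV uA) mulmx_sum_row; apply: eq_bigr => i _.
  rewrite rowK eg add0r /g liftK; congr (_ *: _).
  by rewrite !mxE; apply: eq_bigr => k _; rewrite !mxE mulrC.
exists e, g; split=> // i j.
(* The coordinates of [X j] and the indicator of [j] both represent [X j], so nondegeneracy
   identifies them away from [ord0]; the sum 1 then settles [ord0]. *)
have cj : forall i, i != ord0 -> e i + dot (g i) (X j) - (i == j)%:R = 0.
  have /nondegenerate_lincomb := nd; apply.
  under eq_bigr => k _ do rewrite scalerBr scalerBl.
  rewrite !sumrB -scaler_suml sumrB sum1 sumX.
  rewrite (bigD1 j) //= eqxx scale1r big1 => [|k /negbTE ->]; last exact: scale0r.
  rewrite (bigD1 j) //= eqxx big1 => [|k /negbTE ->] //.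
  by rewrite !addr0 !subrr scale0r subr0.
have [->|/cj /eqP] := eqVneq i ord0; last by rewrite subr_eq0 => /eqP.
have : \sum_i (e i + dot (g i) (X j) - (i == j)%:R) = 0.
  rewrite sumrB sum1 (bigD1 j) //= eqxx big1 => [|k /negbTE ->] //.
  by rewrite addr0 subrr.
rewrite (bigD1 ord0) //= big1 ?addr0 => [/eqP|//].
by rewrite subr_eq0 => /eqP.
Qed.

Section Frame.
Variables (X g : 'I_4 -> 'rV[R]_3) (e : 'I_4 -> R).
Hypothesis frameX : bary_frame X e g.

Lemma frame_sum1 x : \sum_i (e i + dot (g i) x) = 1.
Proof. by case: frameX. Qed.

Lemma frame_sum x : \sum_i (e i + dot (g i) x) *: X i = x.
Proof. by case: frameX. Qed.

Lemma frame_vertex i j : e i + dot (g i) (X j) = (i == j)%:R.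
Proof. by case: frameX. Qed.

Lemma frame_coord (w : 'I_4 -> R) i :
  \sum_j w j = 1 -> e i + dot (g i) (\sum_j w j *: X j) = w i.
Proof.
move=> w1; rewrite sum_affine // (bigD1 i) //= frame_vertex eqxx mulr1 big1 ?addr0 //.
by move=> j ji; rewrite frame_vertex eq_sym (negbTE ji) mulr0.
Qed.

Lemma frame_grad_sum : \sum_i g i = 0.
Proof.
apply/eqP; rewrite -dot_eq0; set s := \sum_i g i.
have := frame_sum1 s; have := frame_sum1 0.
rewrite !big_split /= -!dot_suml -/s dot0r addr0 => -> /eqP.
by rewrite -subr_eq0 addrAC subrr add0r.
Qed.

Lemma frame_edge i j k : dot (g i) (X j - X k) = (i == j)%:R - (i == k)%:R.
Proof. by rewrite -!frame_vertex !dotE; ring. Qed.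

Lemma frame_expand z p : z = \sum_i dot (g i) z *: (X i - p).
Proof.
have {1}<- : \sum_i (e i + dot (g i) z) *: X i -
    \sum_i (e i + dot (g i) 0) *: X i = z by rewrite !frame_sum subr0.
rewrite -sumrB.
under eq_bigr => i _ do rewrite -scalerBl dot0r addr0 addrAC subrr add0r.
under [RHS]eq_bigr => i _ do rewrite scalerBr.
by rewrite sumrB -scaler_suml -dot_suml frame_grad_sum dot0l scale0r subr0.
Qed.

End Frame.

Lemma nondegenerate_inj X : nondegenerate_tetrahedron X -> injective X.
Proof.
move=> /bary_frame_exists[e [g fX]] i j Xij; apply/eqP/negPn/negP => /negbTE ij.
have := frame_vertex fX i i; rewrite Xij (frame_vertex fX) eqxx ij => /eqP.
by rewrite eq_sym oner_eq0.
Qed.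

End Dot.

(** * Mirror images *)

Lemma ord4_rcons (s : seq 'I_4) : uniq s -> (size s < 4)%N ->
  exists l, uniq (rcons s l).
Proof.
move=> us s4; have /card_gt0P[l] : (0 < #|predC (mem s)|)%N.
  by rewrite -(ltn_add2l #|s|) cardC card_ord addn0 (card_uniqP us).
by rewrite inE => ls; exists l; rewrite rcons_uniq ls.
Qed.

Lemma ord4_others (i j : 'I_4) : i != j -> exists k l : 'I_4, uniq [:: i; j; k; l].
Proof.
move=> ij; have [|k us] := @ord4_rcons [:: i; j] _ isT; first by rewrite /= inE ij.
by have [l us'] := ord4_rcons us isT; exists k, l.
Qed.

Lemma ord4_sum (V : nmodType) (i j k l : 'I_4) (F : 'I_4 -> V) :
  uniq [:: i; j; k; l] -> \sum_m F m = F i + F j + F k + F l.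
Proof.
move=> us; rewrite (eq_bigl (mem [:: i; j; k; l])) => [|m].
  rewrite -big_uniq //= !big_cons big_nil addr0.
  by rewrite !addrA.
apply/esym; suff /(_ m) : [:: i; j; k; l] =i predT by [].
apply/subset_cardP; last exact: subset_predT.
by rewrite (card_uniqP us) card_ord.
Qed.

Section Mirror.
Context {R : realType}.
Variables (X g : 'I_4 -> 'rV[R]_3) (e : 'I_4 -> R).
Hypothesis frameX : bary_frame X e g.

Lemma frame_grad_gt0 i : 0 < dot (g i) (g i).
Proof.
rewrite dot_gt0; apply/eqP => gi0.
have [j ij] : exists j : 'I_4, i != j.
  have [->|i0] := eqVneq i ord0; first by exists ord_max.
  by exists ord0.
have := frame_edge frameX i i j.
by rewrite gi0 dot0l eqxx (negbTE ij) subr0 => /eqP; rewrite eq_sym oner_eq0.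
Qed.

Lemma normal_to_face i k y : i != k ->
  (forall m, m != i -> dot y (X m - X k) = 0) ->
  y = dot y (X i - X k) *: g i.
Proof.
move=> ik yX; set s := dot y _.
have yz z : dot (y - s *: g i) z = 0.
  rewrite dotDl dotNl dotZl {1}(frame_expand frameX z (X k)) dot_sumr (bigD1 i) //=.
  rewrite big1 => [|m mi]; first by rewrite dotZr -/s; ring.
  by rewrite dotZr yX // mulr0.
by apply/eqP; rewrite -subr_eq0 -dot_eq0 yz.
Qed.

Definition mirror i : 'rV[R]_3 := X i - (2 / dot (g i) (g i)) *: g i.

(** Comparing the distances to two vertices of the face makes [p - X i] orthogonal to their
    difference. So [p - X i] is a multiple of [g i], and the remaining quadratic equation has a
    single nonzero root. *)
Lemma mirror_unique i p : p != X i ->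
  (forall m, m != i -> sqd p (X m) = sqd (X i) (X m)) -> p = mirror i.
Proof.
have [y ->] : exists y, p = X i + y by exists (p - X i); rewrite addrC subrK.
move=> yX yd0; have [k ik] : exists k : 'I_4, i != k.
  have [->|i0] := eqVneq i ord0; first by exists ord_max.
  by exists ord0.
have yd m : m != i -> dot y y + 2 * dot y (X i - X m) = 0.
  move=> /yd0 /eqP; rewrite -subr_eq0 => /eqP <-.
  by rewrite /sqd !dotE (dotC (X i) y) (dotC (X m) y); ring.
have yE : y = dot y (X i - X k) *: g i.
  apply: (normal_to_face ik) => m mi.
  have := yd m mi; have := yd k; rewrite eq_sym => /(_ ik).
  rewrite !dotE => h1 h2; lra.
have := yd k; rewrite eq_sym => /(_ ik).
move: (dot y _) yE => s yE; rewrite yE !dotE => h.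
have s0 : s != 0.
  by apply: contraNneq yX => s0; rewrite yE s0 scale0r addr0.
have g0 := frame_grad_gt0 i.
rewrite /mirror -scaleNr; congr (_ + _ *: _).
apply: (mulfI s0); apply: (@mulIf _ (dot (g i) (g i))); first exact: lt0r_neq0.
have -> : s * - (2 / dot (g i) (g i)) * dot (g i) (g i) = - (s * 2).
  by field; rewrite lt0r_neq0.
lra.
Qed.

(** The projection of [g j] to the plane of the face opposite [X i]. For [i != j] its length is the
    inverse of the height from [X j] in that triangle. *)
Definition face_grad i j := g j - (dot (g i) (g j) / dot (g i) (g i)) *: g i.

Lemma face_grad_orth i j : dot (g i) (face_grad i j) = 0.
Proof.
rewrite /face_grad !dotE divfK ?subrr // lt0r_neq0 //; exact: frame_grad_gt0.
Qed.

Lemma dot_face_grad i j k :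
  dot (g k) (face_grad i j) = dot (g k) (g j) - dot (g i) (g j) * dot (g i) (g k) / dot (g i) (g i).
Proof. by rewrite /face_grad !dotE (dotC (g k) (g i)); ring. Qed.

Lemma face_grad_expand i j k l : uniq [:: i; j; k; l] ->
  1 = dot (g j) (face_grad i j) * sqd (X j) (X l) +
      dot (g k) (face_grad i j) * dot (X k - X l) (X j - X l).
Proof.
move=> us.
have := frame_expand frameX (face_grad i j) (X l).
rewrite (ord4_sum _ us) face_grad_orth scale0r add0r subrr scaler0 addr0.
move=> /(congr1 (fun y => dot y (X j - X l))).
rewrite [RHS]dotDl !dotZl => <-; rewrite {1}/face_grad dotDl dotNl dotZl !(frame_edge frameX).
move: us => /=; rewrite !inE !negb_or => /and4P[/and3P[ij ik il] /andP[jk jl] kl _].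
by rewrite eqxx (negbTE ij) (negbTE il) (negbTE jl) !subr0 mulr0 subr0.
Qed.

(* In the face opposite to [X i], an edge length is inversely proportional to
   the height on it, i.e. proportional to the norm of a projected gradient. *)
Lemma face_grad_edge i j k l : uniq [:: i; j; k; l] ->
  dot (g j) (face_grad i j) * sqd (X j) (X l) =
  dot (g k) (face_grad i k) * sqd (X k) (X l).
Proof.
move=> us; have us' : uniq [:: i; k; j; l].
  by move: us; rewrite /= !inE !negb_or (eq_sym k j) => /and4P[/and3P[-> -> ->] /andP[-> ->] -> _].
(* The two expansions of 1 have the same mixed term, because [dot (g k) (face_grad i j)] is
   symmetric in [j] and [k]. *)
have := face_grad_expand us; have := face_grad_expand us'.
rewrite (dotC (X j - X l)) (dot_face_grad i j k) (dot_face_grad i k j) (dotC (g j) (g k)).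
lra.
Qed.

Lemma face_grad_gt0 i j : i != j -> 0 < dot (g j) (face_grad i j).
Proof.
move=> ij; have [k [l us]] := ord4_others ij.
have <- : dot (face_grad i j) (face_grad i j) = dot (g j) (face_grad i j).
  by rewrite {1}/face_grad dotDl dotNl dotZl face_grad_orth mulr0 subr0.
rewrite dot_gt0; apply/eqP => fg0; have := face_grad_expand us.
by rewrite fg0 !dot0r !mul0r addr0 => /eqP; rewrite oner_eq0.
Qed.

End Mirror.

(** * Dihedral angles *)

Section Rotation.
Context {R : realType}.
Variables (u v : 'rV[R]_3) (F : 'I_4 -> 'rV[R]_3) (rho : 'I_4 -> R).

Definition axial : Prop :=
  [/\ dot u u = 1, dot v v = 1, dot u v = 0
    & forall m n, dot u (F m - F n) = 0 /\ dot v (F m - F n) = 0].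

(* Points in cylindrical coordinates around the axis through the [F m]. *)
Definition rot (alpha : 'I_4 -> R) m : 'rV[R]_3 :=
  F m + rho m *: (cos (alpha m) *: u + sin (alpha m) *: v).

Hypothesis ax : axial.

Lemma sqd_rot alpha beta m n :
  sqd (rot alpha m) (rot beta n) =
  sqd (F m) (F n) + rho m ^+ 2 + rho n ^+ 2
  - 2 * rho m * rho n * cos (alpha m - beta n).
Proof.
case: ax => uu vv uv /(_ m n)[uF vF].
rewrite /sqd /rot.
set a := alpha m; set b := beta n.
have -> : F m + rho m *: (cos a *: u + sin a *: v)
  - (F n + rho n *: (cos b *: u + sin b *: v)) =
  (F m - F n) + (rho m * cos a - rho n * cos b) *: u
              + (rho m * sin a - rho n * sin b) *: v.
  by apply/rowP => i; rewrite !mxE; ring.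
move: (F m - F n) uF vF => z uz vz.
rewrite !dotE (dotC z u) (dotC z v) (dotC v u) uu vv uv uz vz cosB.
have := cos2Dsin2 a; have := cos2Dsin2 b.
move: (cos a) (cos b) (sin a) (sin b) (rho m) (rho n) => ca cb sa sb p q.
move=> hb ha; transitivity (dot z z + p ^+ 2 * (ca ^+ 2 + sa ^+ 2)
  + q ^+ 2 * (cb ^+ 2 + sb ^+ 2) - 2 * p * q * (ca * cb + sa * sb)); first ring.
by rewrite hb ha !mulr1.
Qed.

Lemma rot_eq alpha beta m : rho m != 0 -> rot alpha m = rot beta m ->
  cos (alpha m) = cos (beta m) /\ sin (alpha m) = sin (beta m).
Proof.
move=> rm /addrI /(scalerI rm); case: ax => uu vv uv _ h.
split.
  move/(congr1 (dot u)): h; rewrite !dotE uu uv; lra.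
by move/(congr1 (dot v)): h; rewrite !dotE (dotC v u) vv uv; lra.
Qed.

Lemma rot_fixed alpha m : rho m = 0 -> rot alpha m = F m.
Proof. by move=> rm; rewrite /rot rm scale0r addr0. Qed.

End Rotation.

Section Dihedral.
Context {R : realType}.
Variables (V : 'I_4 -> 'rV[R]_3) (tile : ('I_4 -> 'rV[R]_3) -> Prop).
Hypothesis V_nd : nondegenerate_tetrahedron V.
Hypothesis V_scalene : forall i j k, uniq [:: i; j; k] ->
  sqd (V i) (V k) != sqd (V j) (V k).
Hypothesis tile_congruent : forall X, tile X -> congruent X V.
Hypothesis tile_mirror : forall X i, tile X ->
  exists Y, [/\ tile Y, forall m, m != i -> Y m = X m & Y i <> X i].
Hypothesis tile_overlap : forall X Y (w w' : 'I_4 -> R), tile X -> tile Y ->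
  (forall m, 0 < w m) -> (forall m, 0 < w' m) ->
  \sum_m w m = 1 -> \sum_m w' m = 1 ->
  \sum_m w m *: X m = \sum_m w' m *: Y m ->
  exists s : 'S_4, forall m, Y m = X (s m).

Lemma tile_nondegenerate X : tile X -> nondegenerate_tetrahedron X.
Proof.
move/tile_congruent => XV; apply: congruent_nondegenerate V_nd => i j.
exact/esym/XV.
Qed.

Section Edge.
Variables (i j : 'I_4) (u v : 'rV[R]_3) (F : 'I_4 -> 'rV[R]_3) (rho : 'I_4 -> R).
Hypothesis ij : i != j.
Hypothesis ax : axial u v F.
Hypothesis rho0 : forall m, m != i -> m != j -> rho m = 0.
Hypothesis rho_i : 0 < rho i.
Hypothesis rho_j : 0 < rho j.

Let W := rot u v F rho.

(** The vertex [a] is reflected in the plane through the axis and the vertex [b]. Both the neighbour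
    given by [tile_mirror] and [W beta] satisfy [mirror_unique]; the condition on the sine ensures
    that [a] really moves. *)
Lemma rot_step (a b : 'I_4) (alpha beta : 'I_4 -> R) :
  [set a; b]%SET = [set i; j]%SET -> tile (W alpha) ->
  sin (alpha a - alpha b) != 0 -> beta b = alpha b ->
  beta a = 2 * alpha b - alpha a -> tile (W beta).
Proof.
move=> abij tW sab bb ba.
have ra : rho a != 0.
  have : a \in [set i; j]%SET by rewrite -abij set21.
  by rewrite !inE => /orP[]/eqP->; rewrite lt0r_neq0.
have r0 m : m != a -> m != b -> rho m = 0.
  move=> ma mb; have : m \notin [set i; j]%SET by rewrite -abij !inE negb_or ma mb.
  by rewrite !inE negb_or => /andP[]; exact: rho0.
have Wm m : m != a -> W beta m = W alpha m.
  have [->|mb ma] := eqVneq m b; first by rewrite /W /rot bb.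
  by rewrite /W !rot_fixed // r0.
have [Y [tY Ym Ya]] := tile_mirror a tW.
suff -> : W beta = Y by [].
apply/funext => m; have [->|ma] := eqVneq m a; last by rewrite Wm ?Ym.
have [e [g fW]] := bary_frame_exists (tile_nondegenerate tW).
have Wa_ne : W beta a != W alpha a.
  apply: contraNneq sab => /(rot_eq ax ra)[].
  rewrite ba => h1 h2; have [x xE] : exists x, alpha a = alpha b + x.
    by exists (alpha a - alpha b); rewrite addrC subrK.
  move: h1 h2; rewrite xE; move: (alpha b) => y.
  have -> : 2 * y - (y + x) = y - x by ring.
  have -> : y + x - y = x by ring.
  rewrite cosB cosD sinB sinD => h1 h2.
  have [h3 h4] : sin y * sin x = 0 /\ cos y * sin x = 0 by split; lra.
  by rewrite -[sin x]mul1r -(cos2Dsin2 y) mulrDl !expr2 -!mulrA h3 h4 !mulr0 addr0.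
transitivity (mirror (W alpha) g a).
  apply: (mirror_unique fW) => // m' ma; rewrite -!(Wm _ ma) /W !(sqd_rot _ ax).
  have [->|mb] := eqVneq m' b; last by rewrite (r0 m') //; ring.
  rewrite bb ba; have -> : 2 * alpha b - alpha a - alpha b = - (alpha a - alpha b) by ring.
  by rewrite cosN.
apply/esym/(mirror_unique fW) => [|m' ma]; first exact/eqP.
by rewrite -Ym // (tile_congruent tY) Ym // (tile_congruent tW).
Qed.

(* Angles of the moving vertices after [n] reflections: they bound the sector
   from [n * t] to [(n + 1) * t]. *)
Definition swing (t : R) (n : nat) (m : 'I_4) : R :=
  if m == i then (n + ~~ odd n)%:R * t
  else if m == j then (n + odd n)%:R * t else 0.

(** The moving vertex at angle [n * t] leaps over the one at [(n + 1) * t] and lands at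
    [(n + 2) * t]; the parity of [n] tells which of the two it is. *)
Lemma swing_tile t n : sin t != 0 -> tile (W (swing t 0)) -> tile (W (swing t n)).
Proof.
move=> st t0.
have si k : swing t k i = (k + ~~ odd k)%:R * t by rewrite /swing eqxx.
have sj k : swing t k j = (k + odd k)%:R * t.
  by rewrite /swing eqxx eq_sym (negbTE ij).
elim: n => // n; have [on|/negbTE en] := boolP (odd n) => tn.
  apply: (rot_step (a := i) (b := j) _ tn) => //; rewrite ?si ?sj /= on /= ?addn0 ?addn1 -?natr1.
  - have -> : n%:R * t - (n%:R + 1) * t = - t by ring.
    by rewrite sinN oppr_eq0.
  - by [].
  - by ring.
apply: (rot_step (a := j) (b := i) _ tn) => //; first by rewrite finset.setUC.
all: rewrite ?si ?sj /= en /= ?addn0 ?addn1 -?natr1.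
- have -> : n%:R * t - (n%:R + 1) * t = - t by ring.
  by rewrite sinN oppr_eq0.
- by [].
- by ring.
Qed.

(* If one of the two moving vertices is above the axial plane and the other one
   below, the tile meets its mirror image in that plane in interior points. *)
Lemma rot_opposed alpha : tile (W alpha) -> tile (W (fun m => - alpha m)) ->
  0 <= sin (alpha i) * sin (alpha j).
Proof.
move=> tW tW'; rewrite leNgt; apply/negP => sinN0.
have [k [l us]] := ord4_others ij.
have := us; rewrite /= !inE !negb_or => /and4P[/and3P[_ ik il] /andP[jk jl] kl _].
have [rk rl] : rho k = 0 /\ rho l = 0 by split; apply: rho0; rewrite eq_sym.
have [si0 sj0] : sin (alpha i) != 0 /\ sin (alpha j) != 0.
  by apply/andP; rewrite -negb_or -mulf_eq0 lt_eqF.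
(* These weights cut the segment between the two moving vertices in a point of the mirror plane. *)
have [A [B [A0 B0 AB]]] : exists A B, [/\ 0 < A, 0 < B &
    A * rho i * sin (alpha i) + B * rho j * sin (alpha j) = 0].
  exists (`|sin (alpha j)| / rho i), (`|sin (alpha i)| / rho j).
  rewrite !divr_gt0 ?normr_gt0 //; split=> //.
  rewrite !divfK ?lt0r_neq0 //.
  have [spi|] := ltrP 0 (sin (alpha i)).
    have smj : sin (alpha j) < 0 by rewrite -(pmulr_rlt0 _ spi).
    by rewrite (gtr0_norm spi) (ltr0_norm smj); ring.
  rewrite le_eqVlt (negbTE si0) /= => smi.
  have spj : 0 < sin (alpha j) by rewrite -(nmulr_rlt0 _ smi).
  by rewrite (ltr0_norm smi) (gtr0_norm spj); ring.
have AB0 : 0 < 2 * (A + B) by rewrite mulr_gt0 // addr_gt0.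
(* Half of the mass sits on the crossing point and a quarter on each of the two fixed vertices, so
   the resulting point is interior to the tile and to its mirror image. *)
have [w [w0 [wi wj wk wl]]] : exists w : 'I_4 -> R, (forall m, 0 < w m) /\
   [/\ w i = A / (2 * (A + B)), w j = B / (2 * (A + B)), w k = 4^-1 & w l = 4^-1].
  exists (fun m => if m == i then A / (2 * (A + B)) else
            if m == j then B / (2 * (A + B)) else 4^-1); split.
    move=> m; case: ifP => _; first exact: divr_gt0.
    by case: ifP => _; [exact: divr_gt0|rewrite invr_gt0 ltr0n].
  rewrite !eqxx (eq_sym j i) (eq_sym k i) (eq_sym k j) (eq_sym l i) (eq_sym l j).
  by rewrite (negbTE ij) (negbTE ik) (negbTE il) (negbTE jk) (negbTE jl).
have w1 : \sum_m w m = 1.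
  rewrite (ord4_sum _ us) wi wj wk wl.
  by field; rewrite lt0r_neq0 ?addr_gt0.
have [] := tile_overlap tW tW' w0 w0 w1 w1.
  rewrite !(ord4_sum _ us) /W.
  have fixW m : rho m = 0 -> rot u v F rho (fun m => - alpha m) m = rot u v F rho alpha m.
    by move=> rm; rewrite !rot_fixed.
  rewrite (fixW k rk) (fixW l rl).
  suff -> : w i *: rot u v F rho alpha i + w j *: rot u v F rho alpha j =
    w i *: rot u v F rho (fun m => - alpha m) i +
    w j *: rot u v F rho (fun m => - alpha m) j by [].
  rewrite /rot !cosN !sinN wi wj; apply/rowP => n; rewrite !mxE -![_ / _ * _]mulrAC -!mulrDl.
  congr (_ / _); apply/eqP; rewrite -subr_eq0; apply/eqP.
  transitivity (2 * (A * rho i * sin (alpha i) + B * rho j * sin (alpha j)) * v 0 n); first ring.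
  by rewrite AB mulr0 mul0r.
(* The relabelling [s] fixes the vertices on the axis. It cannot fix [i], whose sine is nonzero; so
   it sends [i] to [j], which makes the edges from [k] to [i] and to [j] equally long. *)
move=> s Ws.
have sfix m : rho m = 0 -> s m = m.
  by move=> rm; apply: (nondegenerate_inj (tile_nondegenerate tW)); rewrite -Ws /W !rot_fixed.
have [si|sij] := eqVneq (s i) i.
  have := Ws i; rewrite si => /(rot_eq ax (lt0r_neq0 rho_i))[_].
  rewrite sinN => h; case/eqP: si0; lra.
have {}sij : s i = j.
  have ne m : rho m = 0 -> i != m -> s i != m.
    by move=> rm; apply: contra => /eqP h; rewrite -(inj_eq (@perm_inj _ s)) h sfix.
  have : s i \in [:: i; j; k; l].
    have /(_ (s i)) -> // : [:: i; j; k; l] =i predT.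
    apply/subset_cardP; last exact: subset_predT.
    by rewrite (card_uniqP us) card_ord.
  by rewrite !inE (negbTE sij) (negbTE (ne k _ _)) // (negbTE (ne l _ _)) // !orbF => /eqP.
have : uniq [:: i; j; k] by rewrite /= !inE negb_or ij ik jk.
move/V_scalene/eqP; apply.
rewrite -(tile_congruent tW') -[RHS](tile_congruent tW) -sij -(Ws i).
by rewrite -{2}(sfix k rk) -(Ws k).
Qed.

End Edge.
Lemma dihedral_angle X e g i j : tile X -> bary_frame X e g -> i != j ->
  exists2 n : nat, (2 <= n)%N &
    - dot (g i) (g j) / (Num.sqrt (dot (g i) (g i)) * Num.sqrt (dot (g j) (g j))) =
    cos (pi / n%:R).
Proof.
move=> tX fX ij; have Gi := frame_grad_gt0 fX i; have Gj := frame_grad_gt0 fX j.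
set Si := Num.sqrt (dot (g i) _); set Sj := Num.sqrt _; set c := _ / _.
have Si2 : dot (g i) (g i) = Si ^+ 2 by rewrite sqr_sqrtr // ltW.
have Sj2 : dot (g j) (g j) = Sj ^+ 2 by rewrite sqr_sqrtr // ltW.
have Si0 : 0 < Si by rewrite sqrtr_gt0.
have Sj0 : 0 < Sj by rewrite sqrtr_gt0.
have gij : dot (g i) (g j) = - c * Si * Sj.
  by rewrite /c; field; rewrite !lt0r_neq0.
(* The gradients are not parallel, since the projection of [g j] along [g i] is nonzero. *)
have c1 : c ^+ 2 < 1.
  have := face_grad_gt0 fX ij; rewrite dot_face_grad gij Si2 Sj2.
  have -> : Sj ^+ 2 - - c * Si * Sj * (- c * Si * Sj) / Si ^+ 2 = Sj ^+ 2 * (1 - c ^+ 2).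
    by field; rewrite lt0r_neq0.
  by rewrite pmulr_rgt0 ?exprn_gt0 // subr_gt0.
clearbody Si Sj c.
have /andP[cN1 c1'] : -1 < c < 1 by rewrite -ltr_norml -(expr_lt1 (n := 2)) // real_normK ?num_real.
have [/andP[t0 tpi] ct] := acos_def (x := c) ltac:(lra).
set t := acos c in t0 tpi ct.
have {}t0 : 0 < t.
  rewrite lt_neqAle t0 andbT; apply: contraTneq c1' => t0'.
  by rewrite -ct -t0' cos0 ltxx.
have {}tpi : t < pi.
  rewrite lt_neqAle tpi andbT; apply: contraTneq cN1 => tpi'.
  by rewrite -ct tpi' cospi ltxx.
clearbody t.
have s0 : 0 < sin t by rewrite sin_gt0_pi // t0.
have cs : sin t ^+ 2 = 1 - c ^+ 2 by rewrite -(cos2Dsin2 t) ct; ring.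
pose v := Si^-1 *: g i.
pose u := (sin t)^-1 *: (Sj^-1 *: g j + c *: v).
(* The height [Si^-1] of [X i] above its opposite face is its distance from the axis times [sin t];
   likewise for [j]. *)
pose rho (m : 'I_4) := if m == i then (Si * sin t)^-1 else
             if m == j then (Sj * sin t)^-1 else 0.
have gis : [/\ dot (g i) u = 0, dot (g i) v = Si, dot (g j) u = sin t * Sj &
     dot (g j) v = - c * Sj].
  have gijC : dot (g j) (g i) = - c * Si * Sj by rewrite dotC.
  have sj : (sin t)^-1 * (Sj * (1 - c ^+ 2)) = sin t * Sj.
    by rewrite -cs; field; rewrite lt0r_neq0.
  split; rewrite -?sj /u /v !dotE ?gijC ?gij ?Si2 ?Sj2; field; rewrite ?lt0r_neq0 //.
have uu : dot u u = 1.
  rewrite {1}/u dotZl dotDl !dotZl; case: gis => giu _ gju _.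
  rewrite gju giu; field; by rewrite !lt0r_neq0.
have vv : dot v v = 1.
  by rewrite {1}/v dotZl; case: gis => _ -> _ _; rewrite mulVf // lt0r_neq0.
have uv : dot u v = 0.
  by rewrite dotC {1}/v dotZl; case: gis => -> _ _ _; rewrite mulr0.
have vz z : dot v z = Si^-1 * dot (g i) z by rewrite dotZl.
have uz z : dot u z = (sin t)^-1 * (Sj^-1 * dot (g j) z + c * dot v z).
  by rewrite dotZl dotDl !dotZl.
clearbody u v.
pose F m := X m - rho m *: (cos (swing i j t 0 m) *: u + sin (swing i j t 0 m) *: v).
have WX : rot u v F rho (swing i j t 0) = X.
  by apply/funext => m; rewrite /rot /F subrK.
have rho0 m : m != i -> m != j -> rho m = 0.
  by rewrite /rho => /negbTE -> /negbTE ->.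
have rho_i : rho i = (Si * sin t)^-1 by rewrite /rho eqxx.
have rho_j : rho j = (Sj * sin t)^-1 by rewrite /rho eq_sym (negbTE ij) eqxx.
(* The feet have vanishing [i]-th and [j]-th coordinates: they lie on the line through the other two
   vertices, which is the axis. *)
have gF m : e i + dot (g i) (F m) = 0 /\ e j + dot (g j) (F m) = 0.
  case: gis => giu giv gju gjv.
  have [->|mi] := eqVneq m i.
    rewrite /F !dotE giu giv gju gjv !addrA !(frame_vertex fX) eqxx eq_sym (negbTE ij).
    rewrite /swing eqxx /= rho_i add0n mul1r ct.
    by split; field; rewrite !lt0r_neq0.
  have [->|mj] := eqVneq m j.
    rewrite /F !dotE giu giv gju gjv !addrA !(frame_vertex fX) eqxx (negbTE ij).
    rewrite /swing eqxx eq_sym (negbTE ij) /= rho_j addn0 mul0r cos0 sin0.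
    by split; field; rewrite !lt0r_neq0.
  rewrite /F rho0 // scale0r subr0 !(frame_vertex fX) !(eq_sym _ m).
  by rewrite (negbTE mi) (negbTE mj).
clearbody F; have ax : axial u v F.
  split=> // m n; have [gim gjm] := gF m; have [gin gjn] := gF n.
  have giF : dot (g i) (F m - F n) = 0 by rewrite dotDr dotNr; lra.
  have gjF : dot (g j) (F m - F n) = 0 by rewrite dotDr dotNr; lra.
  have vF : dot v (F m - F n) = 0 by rewrite vz giF mulr0.
  by split=> //; rewrite uz gjF vF !mulr0 addr0 mulr0.
have ri0 : 0 < rho i by rewrite rho_i invr_gt0 mulr_gt0.
have rj0 : 0 < rho j by rewrite rho_j invr_gt0 mulr_gt0.
have t1 : tile (rot u v F rho (swing i j t 0)) by rewrite WX.
have swi r n : swing i j r n i = (n + ~~ odd n)%:R * r by rewrite /swing eqxx.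
have swj r n : swing i j r n j = (n + odd n)%:R * r.
  by rewrite /swing eqxx eq_sym (negbTE ij).
(* The neighbour across the face opposite [X i] starts the swing in the other direction. *)
have t2 : tile (rot u v F rho (swing i j (- t) 0)).
  apply: (rot_step (i := i) (j := j) (a := i) (b := j) _ _ _ _ _ t1) => //.
  - by rewrite swi swj /= mul0r mul1r subr0 lt0r_neq0.
  - by rewrite !swj !mul0r.
  - by rewrite !swi !swj /= !mul1r mul0r mulr0 sub0r.
have sN n m : swing i j (- t) n m = - swing i j t n m.
  by rewrite /swing; case: (m == i); [|case: (m == j)]; rewrite ?mulrN ?oppr0.
have opp n : 0 <= sin (n%:R * t) * sin (n.+1%:R * t).
  have h1 := swing_tile ij ax rho0 ri0 rj0 n (lt0r_neq0 s0) t1.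
  have h2 : tile (rot u v F rho (fun m => - swing i j t n m)).
    have <- : swing i j (- t) n = fun m => - swing i j t n m by apply/funext => m.
    by apply: swing_tile => //; rewrite sinN oppr_eq0 lt0r_neq0.
  have := rot_opposed ij ax rho0 ri0 rj0 h1 h2.
  by rewrite swi swj; case: (odd n); rewrite /= addn0 addn1 // mulrC.
have p0 : 0 < pi / t by rewrite divr_gt0 // pi_gt0.
(* This [n] satisfies [n * t <= pi < (n + 1) * t]. A strict first inequality would give the two
   sines in [opp n] opposite signs, as [(n + 1) * t - pi < t < pi]. *)
have /andP[] := truncn_itv (ltW p0); set n := Num.trunc _.
rewrite ler_pdivlMr // ltr_pdivrMr // => ntpi npi.
have n1 : n != 0%N by apply: contraTneq npi => ->; rewrite mul1r -leNgt ltW.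
have n0 : 0 < n%:R :> R by rewrite ltr0n lt0n.
have [npi'|ntpi'] := eqVneq (n%:R * t) pi.
  exists n; last by rewrite -npi' mulrAC divff ?mul1r // lt0r_neq0.
  rewrite ltn_neqAle lt0n n1 andbT; apply: contraTneq tpi => n1'.
  by rewrite -npi' -n1' mul1r ltxx.
have {ntpi ntpi'} ntpi : n%:R * t < pi by rewrite lt_neqAle ntpi'.
have sn : 0 < sin (n%:R * t) by rewrite sin_gt0_pi // mulr_gt0.
have := opp n; rewrite (pmulr_rge0 _ sn) leNgt.
suff -> : sin (n.+1%:R * t) < 0 by [].
rewrite -[n.+1%:R * t](subrK pi) sinDpi oppr_lt0 sin_gt0_pi //.
by rewrite subr_gt0 npi -natr1 /=; lra.
Qed.

End Dihedral.

(** * Coxeter diagrams on four vertices *)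

Section CosineValues.
Context {R : realType}.

(* The square of cos (pi / n) is 0, 1/4, 1/2, (3 + sqrt 5) / 8 for n = 2, ..., 5
   and at least 3/4 afterwards; only the following consequence matters. *)
Definition coxeter_cosine (c : R) : Prop :=
  [\/ c = 0, c = 2^-1, 2^-1 < c /\ c ^+ 2 = 2^-1
    | [/\ 2^-1 < c, c < 1, 9 / 16 < c ^+ 2 & c ^+ 2 != 2 / 3]].

Lemma cos_double (t : R) : cos (2 * t) = 2 * cos t ^+ 2 - 1.
Proof.
have -> : 2 * t = t + t by ring.
by rewrite cosD -!expr2; have := cos2Dsin2 t; lra.
Qed.

Lemma cos_triple (t : R) : cos (3 * t) = 4 * cos t ^+ 3 - 3 * cos t.
Proof.
have -> : 3 * t = 2 * t + t by ring.
rewrite cosD cos_double; have -> : 2 * t = t + t by ring.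
rewrite sinD; have -> : (sin t * cos t + cos t * sin t) * sin t = 2 * cos t * sin t ^+ 2 by ring.
have -> : sin t ^+ 2 = 1 - cos t ^+ 2 by rewrite -(cos2Dsin2 t); ring.
ring.
Qed.

Lemma cos_pi_third : cos (pi / 3) = 2^-1 :> R.
Proof.
have pi0 := pi_gt0 R; have tpi : 3 * (pi / 3) = pi :> R by lra.
have c0 : 0 < cos (pi / 3) :> R by rewrite cos_gt0_pihalf //; lra.
have := cos_triple (pi / 3); rewrite tpi cospi; move: (cos _) c0 => c c0 h.
have /eqP : (c + 1) * (2 * c - 1) ^+ 2 = 0.
  by transitivity (4 * c ^+ 3 - 3 * c + 1); [ring | lra].
by rewrite mulf_eq0 sqrf_eq0 => /orP[]/eqP ?; lra.
Qed.

Lemma coxeter_cosineP n : (2 <= n)%N -> coxeter_cosine (cos (pi / n%:R)).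
Proof.
move=> n2; have pi0 := pi_gt0 R.
have n0 : 0 < n%:R :> R by rewrite ltr0n (ltn_trans _ n2).
have pn0 : 0 < pi / n%:R :> R by rewrite divr_gt0.
have le_pi m : (0 < m)%N -> (m <= n)%N -> pi / n%:R <= pi / m%:R :> R.
  by move=> m0 mn; rewrite ler_pM2l // lef_pV2 ?ler_nat // posrE ltr0n //.
have half : pi / n%:R <= pi / 2 :> R by exact: le_pi.
have c1 : cos (pi / n%:R) < 1 :> R by rewrite -[ltRHS]cos0 ltr_cos ?in_itv /=; lra.
have cE : n%:R * (pi / n%:R) = pi :> R by rewrite mulrCA divff ?mulr1 // lt0r_neq0.
have [->|n2'] := eqVneq n 2%N; first by apply: Or41; exact: cos_pihalf.
have n3 : (3 <= n)%N by rewrite ltn_neqAle eq_sym n2'.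
have c0 : 0 < cos (pi / n%:R) :> R.
  have : pi / n%:R <= pi / 3 :> R by exact: le_pi.
  by move=> h; rewrite cos_gt0_pihalf //; lra.
have [n3'|n3'] := eqVneq n 3%N.
  by apply: Or42; rewrite n3' cos_pi_third.
have n4 : (4 <= n)%N by rewrite ltn_neqAle eq_sym n3'.
have [n4'|n4'] := eqVneq n 4%N.
  apply: Or43; move: c0 cE; rewrite n4'; move: (pi / 4) => t c0 tpi.
  have := cos_double t; have -> : 2 * t = pi / 2 by lra.
  rewrite cos_pihalf; move: (cos t) c0 => c c0 h; split; last by lra.
  rewrite ltNge; apply/negP => c12; nra.
have n5 : (5 <= n)%N by rewrite ltn_neqAle eq_sym n4'.
have [n5'|n5'] := eqVneq n 5%N.
  apply: Or44; move: c1 c0 cE; rewrite n5'; move: (pi / 5) => t c1 c0 tpi.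
  (* At [5 * t = pi] the triple angle is supplementary to the double one, which gives a cubic
     equation for the cosine with the spurious root -1. *)
  have := cos_triple t; have -> : 3 * t = - (2 * t) + pi by lra.
  rewrite cosDpi cosN cos_double; move: (cos t) c0 c1 => c c0 c1 h.
  have /eqP : (c + 1) * (4 * c ^+ 2 - 2 * c - 1) = 0.
    by transitivity (4 * c ^+ 3 - 3 * c + (2 * c ^+ 2 - 1)); [ring | lra].
  rewrite mulf_eq0 => /orP[]/eqP hc; first by lra.
  have c34 : 3 / 4 < c by rewrite ltNge; apply/negP => ?; nra.
  split=> //; [lra | nra | apply/eqP => h2].
  have c56 : c = 5 / 6 by lra.
  by move: h2; rewrite c56; lra.
have n6 : (6 <= n)%N by rewrite ltn_neqAle eq_sym n5'.
(* From 6 on, monotonicity reduces the bound to [cos (pi / 6)], whose square is 3/4. *)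
apply: Or44; have c6 : cos (pi / 6) <= cos (pi / n%:R) :> R.
  have h := le_pi 6 isT n6; rewrite leNgt ltr_cos ?in_itv /=; lra.
have c60 : 0 < cos (pi / 6) :> R by rewrite cos_gt0_pihalf //; lra.
have : 2 * cos (pi / 6) ^+ 2 - 1 = 2^-1 :> R.
  rewrite -cos_double; have -> : 2 * (pi / 6) = pi / 3 :> R by lra.
  exact: cos_pi_third.
move: (cos (pi / 6)) (cos (pi / n%:R)) c60 c6 c0 c1 => b c b0 bc c0 c1 hb.
have hc : 3 / 4 <= c ^+ 2 by nra.
split=> //; [nra | lra |apply/eqP; lra].
Qed.

End CosineValues.

Section Coxeter.
Context {R : realType}.

Definition coxeter_square (A : R) : Prop :=
  [\/ A = 4^-1, A = 2^-1 | [/\ 9 / 16 < A, A < 1 & A != 2 / 3]].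

Lemma coxeter_cosine_square (y : R) : coxeter_cosine y -> y != 0 ->
  0 < y /\ coxeter_square (y ^+ 2).
Proof.
move=> [->|->|[h1 h2]|[h1 h2 h3 h4]]; rewrite ?eqxx // => _; split; try lra.
- by apply: Or31; lra.
- exact: Or32.
- by apply: Or33; split=> //; rewrite expr_lt1 //; lra.
Qed.

(** The equation is the vanishing of the determinant of a path with squared weights [A], [B], [D].
    With [B] = 1/4, an end of 1/4 would force the other to be 2/3; with [B] > 9/16, both ends would
    be 1/4 and [B] = 9/16. These two coincidences are what [coxeter_square] rules out. *)
Lemma path_squares (A B D : R) :
  coxeter_square A -> coxeter_square B -> coxeter_square D ->
  (1 - A) * (1 - D) = B -> A + B < 1 -> D + B < 1 ->
  [/\ A = 2^-1, B = 4^-1 & D = 2^-1].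
Proof.
move=> hA [->|->|[hB _ _]] hD e ab db.
- case: hA e ab => [->|->|[A1 A2 A3]] e ab.
  + by case: hD => [hD|hD|[_ _ /eqP[]]]; lra.
  + by split; lra.
  + case: hD e db => [->|->|[D1 D2 D3]] e db.
    * by case/eqP: A3; lra.
    * lra.
    * suff : (1 - A) * (1 - D) < 4^-1 by lra.
      have h : (1 - A) * (1 - D) <= (1 - A) * (7 / 16) by rewrite ler_pM2l; lra.
      lra.
- have A4 : A = 4^-1 by case: hA => [//|hA|[hA _ _]]; lra.
  have D4 : D = 4^-1 by case: hD => [//|hD|[hD _ _]]; lra.
  by move: e; rewrite A4 D4; lra.
- have A4 : A = 4^-1 by case: hA => [//|hA|[hA _ _]]; lra.
  have D4 : D = 4^-1 by case: hD => [//|hD|[hD _ _]]; lra.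
  by move: e ab db; rewrite A4 D4; lra.
Qed.

Variables (x : 'I_4 -> R) (c : 'I_4 -> 'I_4 -> R).
Hypothesis x0 : forall i, 0 < x i.
Hypothesis c_sym : forall i j, c i j = c j i.
Hypothesis c_cox : forall i j, i != j -> coxeter_cosine (c i j).
Hypothesis xE : forall i j k l, uniq [:: i; j; k; l] ->
  x i = c i j * x j + c i k * x k + c i l * x l.
Hypothesis c_neq : forall i j k, uniq [:: i; j; k] ->
  x j ^+ 2 * (1 - c i j ^+ 2) != x k ^+ 2 * (1 - c i k ^+ 2).

Lemma uniq4 (i j k l : 'I_4) : uniq [:: i; j; k; l] ->
  [/\ uniq [:: j; i; k; l], uniq [:: k; i; j; l], uniq [:: l; i; j; k] &
   [/\ i != j, i != k, i != l, j != k & j != l /\ k != l]].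
Proof.
rewrite /= !inE !negb_or (eq_sym j i) (eq_sym k i) (eq_sym k j) !(eq_sym l).
by move=> /and4P[/and3P[-> -> ->] /andP[-> ->] -> _].
Qed.

Lemma cox_ge i j : i != j -> c i j != 0 -> 2^-1 <= c i j.
Proof. by move=> /c_cox[->|->|[/ltW]|[/ltW]] //; rewrite eqxx. Qed.

Lemma cox_ge0 i j : i != j -> 0 <= c i j.
Proof. by move=> /c_cox[->|->|[h _]|[h _ _ _]]; lra. Qed.

(** Weights at least 1/2 on a triangle already use up the sum of its three equations, so nothing
    connects it to [l]; but then [x l] = 0. *)
Lemma no_triangle i j k l : uniq [:: i; j; k; l] ->
  c i j != 0 -> c i k != 0 -> c j k != 0 -> False.
Proof.
move=> us; have [us1 us2 us3 [ij ik il jk [jl kl]]] := uniq4 us.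
move=> /(cox_ge ij) a /(cox_ge ik) b /(cox_ge jk) d.
have := xE us; have := xE us1; have := xE us2; have := xE us3.
rewrite (c_sym j i) (c_sym k i) (c_sym k j) !(c_sym l).
have := cox_ge0 il; have := cox_ge0 jl; have := cox_ge0 kl.
have := x0 i; have := x0 j; have := x0 k; have := x0 l.
move: (x i) (x j) (x k) (x l) => xi xj xk xl l0 k0 j0 i0 r0 q0 p0 El Ek Ej Ei.
move: (c i j) (c i k) (c j k) (c i l) (c j l) (c k l) a b d p0 q0 r0 El Ek Ej Ei
  => a b d p q r a0 b0 d0 p0 q0 r0 El Ek Ej Ei.
have h1 : 0 <= (a - 2^-1) * (xi + xj) by apply: mulr_ge0; lra.
have h2 : 0 <= (b - 2^-1) * (xi + xk) by apply: mulr_ge0; lra.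
have h3 : 0 <= (d - 2^-1) * (xj + xk) by apply: mulr_ge0; lra.
have p1 := mulr_ge0 p0 (ltW l0); have q1 := mulr_ge0 q0 (ltW l0).
have r1 := mulr_ge0 r0 (ltW l0).
have pz : p * xl = 0 by lra.
have qz : q * xl = 0 by lra.
have rz : r * xl = 0 by lra.
move/eqP: pz; move/eqP: qz; move/eqP: rz.
rewrite !mulf_eq0 !(gt_eqF l0) !orbF => /eqP rz /eqP qz /eqP pz.
by move: El; rewrite pz qz rz; lra.
Qed.

(** The squares of the three weights at the centre [i] sum to 1, and each is 1/4 or at least 1/2.
    This forces 1/4 twice (affine type B3), whereas equal weights would mean equal edges. *)
Lemma no_star i j k l : uniq [:: i; j; k; l] ->
  c j k = 0 -> c j l = 0 -> c k l = 0 -> False.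
Proof.
move=> us; have [us1 us2 us3 [ij ik il jk [jl kl]]] := uniq4 us => zjk zjl zkl.
have := xE us; have := xE us1; have := xE us2; have := xE us3.
rewrite (c_sym j i) (c_sym k i) (c_sym k j) !(c_sym l) zjk zjl zkl !mul0r !addr0.
have Nt y z t : uniq [:: y; z; t] -> x z = c y z * x y -> x t = c y t * x y -> c y z != c y t.
  by move=> /c_neq/eqP ne zE tE; apply/eqP => h; apply: ne; rewrite zE tE h.
move=> El Ek Ej Ei.
have n1 := Nt i j k ltac:(by rewrite /= !inE negb_or ij ik jk) Ej Ek.
have n2 := Nt i j l ltac:(by rewrite /= !inE negb_or ij il jl) Ej El.
have n3 := Nt i k l ltac:(by rewrite /= !inE negb_or ik il kl) Ek El.
have nz y : 0 < x y -> x y = c i y * x i -> c i y != 0.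
  by move=> y0 yE; apply: contraTneq y0 => h; rewrite yE h mul0r ltxx.
have := nz j (x0 j) Ej; have := nz k (x0 k) Ek; have := nz l (x0 l) El.
have sq1 : c i j ^+ 2 + c i k ^+ 2 + c i l ^+ 2 = 1.
  apply: (@mulIf _ (x i)); first exact: lt0r_neq0.
  by rewrite mul1r [RHS]Ei Ej Ek El; ring.
have h12 : (2^-1 : R) ^+ 2 = 4^-1 by lra.
have lev y : i != y -> c i y != 0 -> c i y = 2^-1 \/ 2^-1 <= c i y ^+ 2.
  move=> /c_cox[->|->|[_ ->]|[_ _ h _]]; rewrite ?eqxx //; first by left.
    by right.
  by right; lra.
move=> /(lev l il)[] hl /(lev k ik)[] hk /(lev j ij)[] hj.
all: move: n1 n2 n3 sq1; rewrite ?hl ?hk ?hj ?eqxx ?h12 //.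
all: by have := sqr_ge0 (c i j); have := sqr_ge0 (c i k); have := sqr_ge0 (c i l); lra.
Qed.

(** Only affine type C3 satisfies the equations, and its symmetry [x j = x k] makes the two sides of
    [c_neq] at [i], [j], [l] equal. *)
Lemma no_path i j k l : uniq [:: i; j; k; l] ->
  c i k = 0 -> c i l = 0 -> c j l = 0 -> False.
Proof.
move=> us; have [us1 us2 us3 [ij ik il jk [jl kl]]] := uniq4 us => zik zil zjl.
have := @c_neq i j l ltac:(by rewrite /= !inE negb_or ij il jl).
have := xE us; have := xE us1; have := xE us2; have := xE us3.
rewrite (c_sym j i) (c_sym k i) (c_sym k j) !(c_sym l) zik zil zjl !mul0r !addr0 !add0r.
have := x0 i; have := x0 j; have := x0 k; have := x0 l.
have := c_cox kl; have := c_cox jk; have := c_cox ij.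
move: (c i j) (c j k) (c k l) (x i) (x j) (x k) (x l) => a b d xi xj xk xl.
move=> ca cb cd l0 k0 j0 i0 El Ek Ej Ei; rewrite expr0n subr0 mulr1 => ne.
have a0 : a != 0 by apply: contraTneq i0 => h; rewrite Ei h mul0r ltxx.
have d0 : d != 0 by apply: contraTneq l0 => h; rewrite El h mul0r ltxx.
have [a1 A] := coxeter_cosine_square ca a0.
have [d1 D] := coxeter_cosine_square cd d0.
(* Eliminating the ends of the path leaves two equations in [xj] and [xk]; their product gives
   [e3]. *)
have e1 : xj * (1 - a ^+ 2) = b * xk by rewrite mulrBr mulr1 {1}Ej Ei; ring.
have e2 : xk * (1 - d ^+ 2) = b * xj by rewrite mulrBr mulr1 {1}Ek El; ring.
have b0 : b != 0.
  apply/eqP => h; move: e1; rewrite h mul0r => /eqP.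
  by rewrite mulf_eq0 (gt_eqF j0) /= => /eqP; case: A => [||[]]; lra.
have [b1 B] := coxeter_cosine_square cb b0.
have e3 : (1 - a ^+ 2) * (1 - d ^+ 2) = b ^+ 2.
  apply: (@mulfI _ (xj * xk)); first by rewrite mulf_neq0 ?lt0r_neq0.
  transitivity ((xj * (1 - a ^+ 2)) * (xk * (1 - d ^+ 2))); first ring.
  by rewrite e1 e2; ring.
have ab : a ^+ 2 + b ^+ 2 < 1.
  suff : xj * b ^+ 2 < xj * (1 - a ^+ 2) by rewrite ltr_pM2l //; lra.
  rewrite e1 {1}Ek; have := mulr_gt0 b1 (mulr_gt0 d1 l0); lra.
have db : d ^+ 2 + b ^+ 2 < 1.
  suff : xk * b ^+ 2 < xk * (1 - d ^+ 2) by rewrite ltr_pM2l //; lra.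
  rewrite e2 {1}Ej; have := mulr_gt0 b1 (mulr_gt0 a1 i0); lra.
have xl2 : xl ^+ 2 = d ^+ 2 * xk ^+ 2 by rewrite El; ring.
rewrite xl2 in ne.
have b12 : b ^+ 2 = 4^-1 -> b = 2^-1.
  move=> h; have /eqP : (b - 2^-1) * (b + 2^-1) = 0 by transitivity (b ^+ 2 - 4^-1); [field|lra].
  by rewrite mulf_eq0 => /orP[]/eqP; lra.
have [hA hB hD] := path_squares A B D e3 ab db.
have {}b12 := b12 hB; rewrite hA b12 in e1; rewrite hA hD in ne.
have xjk : xj = xk by lra.
by case/eqP: ne; rewrite xjk; lra.
Qed.

(** Summing the four equations forces every weight to be exactly 1/2 (affine type A3); then [x j]
    and [x l] are both the mean of [x i] and [x k]. *)
Lemma no_cycle i j k l : uniq [:: i; j; k; l] ->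
  c i k = 0 -> c j l = 0 -> c i j != 0 -> c j k != 0 -> c k l != 0 -> c i l != 0 -> False.
Proof.
move=> us; have [us1 us2 us3 [ij ik il jk [jl kl]]] := uniq4 us => zik zjl.
move=> /(cox_ge ij) a /(cox_ge jk) b /(cox_ge kl) d /(cox_ge il) f.
have := @c_neq i j l ltac:(by rewrite /= !inE negb_or ij il jl).
have := xE us; have := xE us1; have := xE us2; have := xE us3.
rewrite (c_sym j i) (c_sym k i) (c_sym k j) !(c_sym l) zik zjl !mul0r !addr0 !add0r.
have := x0 i; have := x0 j; have := x0 k; have := x0 l.
move: (c i j) (c j k) (c k l) (c i l) a b d f (x i) (x j) (x k) (x l).
move=> a b d f a0 b0 d0 f0 xi xj xk xl l0 k0 j0 i0 El Ek Ej Ei /eqP; apply.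
have h1 : 0 <= (a - 2^-1) * (xi + xj) by apply: mulr_ge0; lra.
have h2 : 0 <= (b - 2^-1) * (xj + xk) by apply: mulr_ge0; lra.
have h3 : 0 <= (d - 2^-1) * (xk + xl) by apply: mulr_ge0; lra.
have h4 : 0 <= (f - 2^-1) * (xi + xl) by apply: mulr_ge0; lra.
have half (y s t : R) : 0 < s -> 0 < t -> (y - 2^-1) * (s + t) = 0 -> y = 2^-1.
  by move=> s0 t0 /eqP; rewrite mulf_eq0 => /orP[]/eqP; lra.
have a12 : a = 2^-1 by apply: (half _ xi xj) => //; lra.
have b12 : b = 2^-1 by apply: (half _ xj xk) => //; lra.
have d12 : d = 2^-1 by apply: (half _ xk xl) => //; lra.
have f12 : f = 2^-1 by apply: (half _ xi xl) => //; lra.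
rewrite a12 b12 d12 f12 in El Ek Ej Ei *.
by have -> : xj = xl by lra.
Qed.

(* Every graph on four vertices contains a triangle, a spanning 4-cycle without
   diagonals, or is a subgraph of a star or of a path. *)
Lemma no_coxeter_scalene : False.
Proof.
pose i := @Ordinal 4 0 isT; pose j := @Ordinal 4 1 isT.
pose k := @Ordinal 4 2 isT; pose l := @Ordinal 4 3 isT.
have [ij|ij] := eqVneq (c i j) 0; have [ik|ik] := eqVneq (c i k) 0;
have [il|il] := eqVneq (c i l) 0; have [jk|jk] := eqVneq (c j k) 0;
have [jl|jl] := eqVneq (c j l) 0; have [kl|kl] := eqVneq (c k l) 0.
all: first
  [ by apply: (@no_triangle i j k l); rewrite // c_sym
  | by apply: (@no_triangle i j l k); rewrite // c_sym
  | by apply: (@no_triangle i k l j); rewrite // c_sym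
  | by apply: (@no_triangle j k l i); rewrite // c_sym
  | by apply: (@no_star i j k l); rewrite // c_sym
  | by apply: (@no_star j i k l); rewrite // c_sym
  | by apply: (@no_star k i j l); rewrite // c_sym
  | by apply: (@no_star l i j k); rewrite // c_sym
  | by apply: (@no_path i j k l); rewrite // c_sym
  | by apply: (@no_path i j l k); rewrite // c_sym
  | by apply: (@no_path i k j l); rewrite // c_sym
  | by apply: (@no_path i k l j); rewrite // c_sym
  | by apply: (@no_path i l j k); rewrite // c_sym
  | by apply: (@no_path i l k j); rewrite // c_sym
  | by apply: (@no_path j i k l); rewrite // c_sym
  | by apply: (@no_path j i l k); rewrite // c_sym
  | by apply: (@no_path j k i l); rewrite // c_sym
  | by apply: (@no_path j l i k); rewrite // c_sym
  | by apply: (@no_path k i j l); rewrite // c_sym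
  | by apply: (@no_path k j i l); rewrite // c_sym
  | by apply: (@no_cycle i j k l); rewrite // c_sym
  | by apply: (@no_cycle i j l k); rewrite // c_sym
  | by apply: (@no_cycle i k j l); rewrite // c_sym ].
Qed.

End Coxeter.

(** * Local finiteness and neighbours *)

Section Tiling.
Context {R : realType}.
Implicit Types (X Y : 'I_4 -> 'rV[R]_3) (x y z u v : 'rV[R]_3) (f h : 'rV[R]_3 -> 'rV[R]_3).

Lemma cauchy_schwarz u v : dot u v ^+ 2 <= dot u u * dot v v.
Proof.
have [->|v0] := eqVneq v 0; first by rewrite !dot0r expr0n mulr0.
have vv : 0 < dot v v by rewrite dot_gt0.
rewrite -subr_ge0 -(pmulr_rge0 _ vv).
have -> : dot v v * (dot u u * dot v v - dot u v ^+ 2) =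
  dot (dot v v *: u - dot u v *: v) (dot v v *: u - dot u v *: v).
  by rewrite !dotE (dotC v u); ring.
exact: dot_ge0.
Qed.

Lemma ball_sqd (p : 'rV[R]_3) (r : R) : 0 < r -> exists2 d : R, 0 < d &
  forall z z', ball p d z -> ball p d z' -> sqd z z' < r.
Proof.
(* Each coordinate differs by less than [2 * d], so the three squares sum to at most [3 * (r / 6)],
   below [r]. *)
move=> r0; exists (Num.sqrt (r / 24)); first by rewrite sqrtr_gt0 divr_gt0.
move=> z z' pz pz'; set d := Num.sqrt _ in pz pz'.
have d2 : d ^+ 2 = r / 24 by rewrite sqr_sqrtr // divr_ge0 // ltW.
suff zz k : (z 0 k - z' 0 k) ^+ 2 <= r / 6.
  apply: (@le_lt_trans _ _ (\sum_(k < 3) r / 6)); last first.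
    by rewrite sumr_const card_ord -mulr_natr; lra.
  by apply: ler_sum => k _; rewrite !mxE -expr2.
have := pz.2 0 k; have := pz'.2 0 k; rewrite /ball /= !ltr_distl => /andP[h1 h2] /andP[h3 h4].
have -> : r / 6 = (2 * d) ^+ 2 by rewrite exprMn d2; field.
by rewrite -[_ ^+ 2]real_normK ?num_real // lerXn2r ?nnegrE ?normr_ge0 // ?ler_norml; lra.
Qed.

Lemma positive_near X e g y : (forall i, 0 < e i + dot (g i) y) ->
  exists2 r : R, 0 < r & forall z, sqd z y < r -> forall i : 'I_4, 0 < e i + dot (g i) z.
Proof.
(* By Cauchy-Schwarz, [r i] keeps the [i]-th coordinate positive; the added 1 keeps the denominator
   positive. *)
move=> pos; pose r i := (e i + dot (g i) y) ^+ 2 / (1 + dot (g i) (g i)).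
have g1 i : 0 < 1 + dot (g i) (g i) by have := dot_ge0 (g i); lra.
have r0 i : 0 < r i by rewrite divr_gt0 ?exprn_gt0.
have rs i : (r i)^-1 <= \sum_j (r j)^-1.
  by rewrite (bigD1 i) //= lerDl sumr_ge0 // => j _; rewrite invr_ge0 ltW.
have s0 : 0 < \sum_j (r j)^-1 by apply: lt_le_trans (rs ord0); rewrite invr_gt0.
(* A positive lower bound of all [r i], in place of their minimum. *)
exists (\sum_j (r j)^-1)^-1; first by rewrite invr_gt0.
move=> z zy i.
have {zy} zr : sqd z y < r i.
  by apply: lt_le_trans zy _; rewrite -[leRHS]invrK lef_pV2 ?posrE ?invr_gt0.
have := cauchy_schwarz (g i) (z - y).
have -> : e i + dot (g i) z = e i + dot (g i) y + dot (g i) (z - y).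
  by rewrite !dotE; ring.
rewrite -/(sqd z y); move: (dot _ (z - y)) => t ht.
move: zr; rewrite /r ltr_pdivlMr // => zr.
have : t ^+ 2 < (e i + dot (g i) y) ^+ 2.
  by have := sqd_ge0 z y; move: ht zr; rewrite mulrDr mulr1 mulrC; lra.
have := pos i; move: (e i + _) => s s0' ts; rewrite ltNge; apply/negP; nra.
Qed.

Lemma interior_tetrahedron X (w : 'I_4 -> R) : nondegenerate_tetrahedron X ->
  (forall i, 0 < w i) -> \sum_i w i = 1 ->
  interior (tetrahedron X) (\sum_i w i *: X i).
Proof.
move=> /bary_frame_exists[e [g fX]] w0 w1.
have [|r r0 hr] := @positive_near X e g (\sum_i w i *: X i).
  by move=> i; rewrite (frame_coord fX).
have [d d0 hd] := ball_sqd (\sum_i w i *: X i) r0.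
apply: filterS (nbhsx_ballx _ _ d0) => z zd.
have zpos := hr z (hd _ _ zd (ballxx _ d0)).
exists (fun i => e i + dot (g i) z); split.
- by move=> i; exact/ltW.
- by move=> i; rewrite inE.
- exact: frame_sum1 fX _.
- by rewrite (frame_sum fX).
Qed.

Lemma isometry_congruent f X : is_isometry f -> congruent X (f \o X).
Proof. by move=> hf i j; exact/esym/eucl_dist_inj/hf. Qed.

Lemma isometry_sum f X (w : 'I_4 -> R) : is_isometry f -> \sum_i w i = 1 ->
  f (\sum_i w i *: X i) = \sum_i w i *: f (X i).
Proof.
move=> hf w1; set x := \sum_i _.
have : \sum_i w i *: ((f \o X) i - f x) = 0.
  apply: (congruent_lincomb (a := x) (isometry_congruent X hf)).
    by move=> i; exact/esym/eucl_dist_inj/hf.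
  under eq_bigr => i _ do rewrite scalerBr.
  by rewrite sumrB -scaler_suml w1 scale1r subrr.
under eq_bigr => i _ do rewrite scalerBr.
by rewrite sumrB -scaler_suml w1 scale1r => /eqP; rewrite subr_eq0 => /eqP.
Qed.

Lemma hull_image f X J : is_isometry f -> f @` hull X J = hull (f \o X) J.
Proof.
move=> hf; apply/seteqP; split=> y.
  by case=> _ [w [w0 wJ w1 ->]] <-; exists w; split=> //; exact: isometry_sum.
case=> w [w0 wJ w1 ->]; exists (\sum_i w i *: X i); last exact: isometry_sum.
by exists w.
Qed.

End Tiling.

Section FaceToFace.
Context {R : realType}.
Variables (V : 'I_4 -> 'rV[R]_3) (F : set ('rV[R]_3 -> 'rV[R]_3)).
Hypothesis V_nd : nondegenerate_tetrahedron V.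
Hypothesis F_iso : forall f, F f -> is_isometry f.
Hypothesis F_cover : \bigcup_(f in F) (f @` tetrahedron V) = [set: 'rV[R]_3].
Hypothesis F_disj : forall f g, F f -> F g -> f <> g ->
  interior (f @` tetrahedron V) `&` interior (g @` tetrahedron V) = set0.
Hypothesis F_face : forall f g, F f -> F g -> f <> g ->
  let S := (f @` tetrahedron V) `&` (g @` tetrahedron V) in
  S = set0 \/
  exists2 k : nat, (1 <= k <= 3)%N & is_face V f k S /\ is_face V g k S.

Lemma image_nondegenerate f : F f -> nondegenerate_tetrahedron (f \o V).
Proof. by move=> /F_iso/isometry_congruent h; exact: congruent_nondegenerate (h V) V_nd. Qed.

Lemma copies_disjoint f h (w w' : 'I_4 -> R) : F f -> F h ->
  (forall m, 0 < w m) -> (forall m, 0 < w' m) ->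
  \sum_m w m = 1 -> \sum_m w' m = 1 ->
  \sum_m w m *: f (V m) = \sum_m w' m *: h (V m) -> f = h.
Proof.
move=> Ff Fh w0 w0' w1 w1' ww'; apply: contrapT => fh.
have := F_disj Ff Fh fh; rewrite /tetrahedron !hull_image; try exact: F_iso.
apply/eqP/set0P; exists (\sum_m w m *: f (V m)); split.
  exact: (interior_tetrahedron (image_nondegenerate Ff)).
by rewrite ww'; exact: (interior_tetrahedron (image_nondegenerate Fh)).
Qed.

Let c := \sum_m (4^-1 : R) *: V m.

Lemma quarter_sum : \sum_(m < 4) (4^-1 : R) = 1.
Proof. by rewrite sumr_const card_ord -[LHS]mulr_natr mulVf. Qed.

Lemma third_sum (i : 'I_4) : \sum_m (if m == i then 0 else 3^-1) = 1 :> R.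
Proof.
rewrite (bigD1 i) //= eqxx add0r (eq_bigr (fun=> 3^-1)) => [|m /negbTE -> //].
rewrite sumr_const; have -> : #|[pred m | m != i]| = 3%N.
  by have := cardC1 i; rewrite card_ord.
by rewrite -[LHS]mulr_natr mulVf.
Qed.

(** Local finiteness. A centroid [h c] close to [f c] is interior to the copy [f], and it is
    interior to the copy [h] anyway; the radius comes from [V] alone because isometries preserve
    it. *)
Lemma copies_separated : exists2 r : R, 0 < r &
  forall f h, F f -> F h -> sqd (f c) (h c) < r -> f = h.
Proof.
have [e [g fV]] := bary_frame_exists V_nd.
have [|r r0 hr] := @positive_near _ V e g c.
  by move=> m; rewrite (frame_coord fV _ quarter_sum).
exists r => // f h Ff Fh fh.
have [e' [g' ffV]] := bary_frame_exists (image_nondegenerate Ff).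
pose w m := e' m + dot (g' m) (h c).
have w1 : \sum_m w m = 1 by exact: frame_sum1 ffV _.
have wE : \sum_m w m *: f (V m) = h c by exact: frame_sum ffV _.
have q0 (m : 'I_4) : 0 < 4^-1 :> R by rewrite invr_gt0.
apply: (@copies_disjoint f h w (fun=> 4^-1)) => //; last first.
- by rewrite wE /c (isometry_sum V (F_iso Fh)) // quarter_sum.
- exact: quarter_sum.
(* The point with coordinates [w] in [V] is sent by [f] to [h c], so it is as close to [c] as [h c]
   is to [f c]. *)
move=> m; rewrite -(frame_coord fV m w1); apply: hr.
suff -> : sqd (\sum_j w j *: V j) c = sqd (f (\sum_j w j *: V j)) (f c).
  by rewrite (isometry_sum V (F_iso Ff)) // wE sqdC.
exact/esym/eucl_dist_inj/(F_iso Ff).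
Qed.

Lemma copy_diameter : exists2 D : R, 0 < D & forall f x y, F f ->
  (f @` tetrahedron V) x -> (f @` tetrahedron V) y -> forall k, `|x 0 k - y 0 k| <= D.
Proof.
pose B := \sum_m \sum_k `|V m 0 k|.
have B0 : 0 <= B by apply: sumr_ge0 => m _; exact: sumr_ge0.
have TB a k : tetrahedron V a -> `|a 0 k| <= B.
  case=> w [w0 _ w1 ->]; rewrite summxE; apply: le_trans (ler_norm_sum _ _ _) _.
  apply: ler_sum => m _; rewrite mxE normrM ger0_norm //.
  apply: (@le_trans _ _ `|V m 0 k|).
    rewrite ler_piMl // -w1 (bigD1 m) //= lerDl; exact: sumr_ge0.
  by rewrite (bigD1 k) //= lerDl; exact: sumr_ge0.
(* Three squared differences of at most [(2 * B) ^+ 2] each; adding 1 turns a bound on the square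
   into one on the absolute value. *)
exists (12 * B ^+ 2 + 1); first by have := sqr_ge0 B; lra.
move=> f x y Ff [a Ta <-] [b Tb <-] k.
have ab : sqd (f a) (f b) <= 12 * B ^+ 2.
  have -> : sqd (f a) (f b) = sqd a b by exact/eucl_dist_inj/(F_iso Ff).
  apply: (@le_trans _ _ (\sum_(k < 3) 4 * B ^+ 2)); last first.
    by rewrite sumr_const card_ord -mulr_natr; lra.
  apply: ler_sum => n _; rewrite !mxE -expr2.
  have := TB a n Ta; have := TB b n Tb; rewrite !ler_norml => /andP[h1 h2] /andP[h3 h4].
  nra.
have : (f a 0 k - f b 0 k) ^+ 2 <= 12 * B ^+ 2.
  apply: le_trans ab; rewrite /sqd /dot (bigD1 k) //= !mxE -expr2 lerDl.
  by apply: sumr_ge0 => n _; rewrite -expr2 sqr_ge0.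
move: (f a 0 k - _) => t ht; have B2 := sqr_ge0 B.
by rewrite ler_norml; apply/andP; split; nra.
Qed.

(** The barycentre [x] of the face is approached from outside by the points [y n]. Infinitely many
    of them lie in a single other copy, by compactness and separation of centroids, and that copy
    contains the limit [x]. *)
Lemma neighbour_copy f i : F f -> exists h, [/\ F h, h <> f &
  (h @` tetrahedron V) (\sum_m (if m == i then 0 else 3^-1) *: f (V m))].
Proof.
move=> Ff; set x := \sum_m _.
have [e [g ffV]] := bary_frame_exists (image_nondegenerate Ff).
pose y (n : nat) := x + n.+1%:R^-1 *: (x - f (V i)).
have w1 := third_sum i.
have xi : e i + dot (g i) x = 0.
  by rewrite (frame_coord (X := f \o V) ffV) // eqxx.
have yi n : e i + dot (g i) (y n) < 0.
  have -> : e i + dot (g i) (y n) = (e i + dot (g i) x) +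
     n.+1%:R^-1 * ((e i + dot (g i) x) - (e i + dot (g i) (f (V i)))).
    by rewrite /y !dotE; ring.
  rewrite xi (frame_vertex ffV i i) eqxx add0r sub0r mulrN mulr1 oppr_lt0.
  by rewrite invr_gt0 ltr0n.
have /choice[G HG] n : exists h, F h /\ (h @` tetrahedron V) (y n).
  have : [set: 'rV[R]_3] (y n) by [].
  by rewrite -F_cover => -[h Fh hy]; exists h.
have GF n : G n <> f.
  move=> Gf; have [_] := HG n; rewrite Gf /tetrahedron hull_image; last exact: F_iso.
  case=> w [w0 _ ws yE]; have := yi n; rewrite yE (frame_coord (X := f \o V) ffV) // ltNge.
  by rewrite w0.
have [r r0 sep] := copies_separated.
have [D D0 diam] := copy_diameter.
have Tc : tetrahedron V c.
  by exists (fun=> 4^-1); split=> [m|m||//]; [rewrite invr_ge0|rewrite inE|exact: quarter_sum].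
pose z n := G n c.
pose M k := `|x 0 k| + `|(x - f (V i)) 0 k| + D.
have zM n k : `|z n 0 k| <= M k.
  have h1 : `|z n 0 k - y n 0 k| <= D.
    by have [FG Gy] := HG n; apply: diam FG _ Gy _; exists c.
  have h2 : `|y n 0 k| <= `|x 0 k| + `|(x - f (V i)) 0 k|.
    rewrite /y !mxE; apply: le_trans (ler_normD _ _) _; rewrite lerD2l normrM.
    rewrite ler_piMl // ger0_norm ?invr_ge0 // invf_le1 ?ltr0n // ler1n //.
  rewrite -(subrK (y n 0 k) (z n 0 k)); apply: le_trans (ler_normD _ _) _.
  by rewrite /M addrC lerD.
(* The centroids stay in a box, hence cluster at [p]; those near [p] belong to one and the same
   copy. *)
have [|p [_ clp]] := @rV_compact R 3 (fun k => `[- M k, M k]%classic)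
  (fun k => @segment_compact R _ _) (z @ \oo) _.
  by exists 0%N => // n _ k; rewrite /= in_itv /= -ler_norml; exact: zM.
have [d d0 hd] := ball_sqd p r0.
have freq N : exists2 n, (N <= n)%N & ball p d (z n).
  have [|q [[n /= Nn <-] pq]] := clp [set z n | n in [set n | (N <= n)%N]] (ball p d) _ (nbhsx_ballx _ _ d0).
    by exists N => // n /= Nn; exists n.
  by exists n.
have [n0 _ zn0] := freq 0%N.
exists (G n0); split=> //; first by case: (HG n0).
have [FG _] := HG n0.
have {freq} freq N : exists2 n, (N <= n)%N & (G n0 @` tetrahedron V) (y n).
  have [n Nn zn] := freq N; exists n => //.
  have [FGn Gy] := HG n; suff -> : G n0 = G n by [].
  by apply: sep => //; exact: hd.
move: freq; rewrite /tetrahedron hull_image; last exact: F_iso.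
move=> freq; have [e' [g' fGV]] := bary_frame_exists (image_nondegenerate FG).
exists (fun m => e' m + dot (g' m) x); split.
- move=> m; rewrite leNgt; apply/negP => neg.
  (* The [m]-th coordinate of [y n] is [s + t / (n + 1)]; if [s] were negative, it would be negative
     for large [n]. *)
  pose s := e' m + dot (g' m) x; pose t := dot (g' m) (x - f (V i)).
  have s0 : 0 < - s by rewrite oppr_gt0.
  have : 0 <= `|t| / - s by rewrite divr_ge0 // ltW.
  move/truncn_itv => /andP[_]; set N := Num.trunc _ => hN.
  have [n Nn [w [w0 _ ws yE]]] := freq N.
  have : 0 <= e' m + dot (g' m) (y n) by rewrite yE (frame_coord (X := G n0 \o V) fGV).
  have -> : e' m + dot (g' m) (y n) = n.+1%:R^-1 * (n.+1%:R * s + t).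
    rewrite mulrDr mulrA mulVf ?mul1r; last by rewrite pnatr_eq0.
    by rewrite /y dotDr dotZr addrA.
  rewrite pmulr_rge0 ?invr_gt0 ?ltr0n // leNgt => /negP; apply.
  move: hN; rewrite ltr_pdivrMr // => hN.
  have : N.+1%:R * - s <= n.+1%:R * - s by rewrite ler_pM2r // ler_nat ltnS.
  have := ler_norm t; rewrite !mulrN; lra.
- by move=> m; rewrite inE.
- exact: frame_sum1 fGV _.
- by rewrite (frame_sum fGV).
Qed.

End FaceToFace.

(** * Tilings by mirror images *)

Section Rigid.
Context {R : realType}.
Variables (V : 'I_4 -> 'rV[R]_3) (F : set ('rV[R]_3 -> 'rV[R]_3)).
Hypothesis V_nd : nondegenerate_tetrahedron V.
Hypothesis F_iso : forall f, F f -> is_isometry f.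
Hypothesis F_cover : \bigcup_(f in F) (f @` tetrahedron V) = [set: 'rV[R]_3].
Hypothesis F_disj : forall f g, F f -> F g -> f <> g ->
  interior (f @` tetrahedron V) `&` interior (g @` tetrahedron V) = set0.
Hypothesis F_face : forall f g, F f -> F g -> f <> g ->
  let S := (f @` tetrahedron V) `&` (g @` tetrahedron V) in
  S = set0 \/
  exists2 k : nat, (1 <= k <= 3)%N & is_face V f k S /\ is_face V g k S.
Hypothesis V_scalene : forall i j k, uniq [:: i; j; k] ->
  sqd (V i) (V k) != sqd (V j) (V k).
Hypothesis V_rigid : forall (s : 'S_4) i,
  (forall m n, m != i -> n != i -> sqd (V (s m)) (V (s n)) = sqd (V m) (V n)) ->
  forall m n, sqd (V (s m)) (V (s n)) = sqd (V m) (V n).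

(** A labelled copy. Congruence with [V] restricts [s] to symmetries of the tetrahedron; this
    freedom lets a neighbour carry the same labels on the common face. *)
Definition tile (X : 'I_4 -> 'rV[R]_3) : Prop := exists f (s : 'S_4),
  [/\ F f, congruent X V & forall i, X i = f (V (s i))].

Lemma perm_lincomb (s : 'S_4) (w : 'I_4 -> R) (X : 'I_4 -> 'rV[R]_3) :
  \sum_m w m *: X (s m) = \sum_m w ((s^-1)%g m) *: X m.
Proof.
rewrite [RHS](reindex_inj (@perm_inj _ s)) /=.
by apply: eq_bigr => m _; rewrite permK.
Qed.

Lemma tile_same_copy f h (s t : 'S_4) (w w' : 'I_4 -> R) : F f -> F h ->
  (forall m, 0 < w m) -> (forall m, 0 < w' m) ->
  \sum_m w m = 1 -> \sum_m w' m = 1 ->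
  \sum_m w m *: f (V (s m)) = \sum_m w' m *: h (V (t m)) -> f = h.
Proof.
move=> Ff Fh w0 w0' w1 w1'.
rewrite (perm_lincomb s w (f \o V)) (perm_lincomb t w' (h \o V)).
apply: (copies_disjoint V_nd F_iso F_disj Ff Fh) => //.
- by rewrite -w1 [RHS](reindex_inj (@perm_inj _ (s^-1)%g)).
- by rewrite -w1' [RHS](reindex_inj (@perm_inj _ (t^-1)%g)).
Qed.

Lemma tile_overlap X Y (w w' : 'I_4 -> R) : tile X -> tile Y ->
  (forall m, 0 < w m) -> (forall m, 0 < w' m) ->
  \sum_m w m = 1 -> \sum_m w' m = 1 ->
  \sum_m w m *: X m = \sum_m w' m *: Y m ->
  exists s : 'S_4, forall m, Y m = X (s m).
Proof.
move=> [f [s [Ff _ Xf]]] [h [t [Fh _ Yh]]] w0 w0' w1 w1'.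
under eq_bigr => m _ do rewrite Xf.
under [in RHS]eq_bigr => m _ do rewrite Yh.
move=> /(tile_same_copy Ff Fh w0 w0' w1 w1') fh.
by exists (t * s^-1)%g => m; rewrite Xf Yh permM permKV fh.
Qed.

Lemma tile_congruent X : tile X -> congruent X V.
Proof. by case=> f [s []]. Qed.

(* A vertex of one face, being an extreme point, is a vertex of any other
   simplex with the same hull. *)
Lemma shared_vertex (X Y : 'I_4 -> 'rV[R]_3) (J : {set 'I_4}) m :
  nondegenerate_tetrahedron X -> hull Y J (X m) ->
  (forall k, k \in J -> tetrahedron X (Y k)) -> exists2 k, k \in J & X m = Y k.
Proof.
move=> /bary_frame_exists[e [g fX]] [w [w0 wJ w1 XmE]] JT.
have [k wk] : exists k, 0 < w k.
  apply: contrapT => nk; move: w1; rewrite big1 => [/eqP|k _].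
    by rewrite eq_sym oner_eq0.
  by apply/eqP; rewrite eq_le w0 andbT leNgt; apply/negP => wk; apply: nk; exists k.
have kJ : k \in J by apply/negPn/negP => /wJ wk0; rewrite wk0 ltxx in wk.
exists k => //.
have lam0 n l : n \in J -> 0 <= e l + dot (g l) (Y n).
  by move=> /JT[v [v0 _ v1 ->]]; rewrite (frame_coord fX).
(* The [l]-th coordinate of [X m] is 0 and is an average of nonnegative coordinates, so it vanishes
   at every point of positive weight. *)
have lamk l : l != m -> e l + dot (g l) (Y k) = 0.
  move=> lm; have := frame_vertex fX l m; rewrite (negbTE lm) XmE sum_affine // => /eqP.
  rewrite psumr_eq0 => [/allP/(_ k (mem_index_enum k))|n _].
    by rewrite /= mulf_eq0 (gt_eqF wk) => /eqP.
  have [nJ|/wJ ->] := boolP (n \in J); last by rewrite mul0r.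
  by rewrite mulr_ge0 ?lam0.
rewrite -(frame_sum fX (Y k)) (bigD1 m) //= big1 => [|l lm]; last by rewrite lamk ?scale0r.
have := frame_sum1 fX (Y k); rewrite (bigD1 m) //= big1 => [|l lm]; last by rewrite lamk.
by rewrite !addr0 => ->; rewrite scale1r.
Qed.

(** The copy through the barycentre of the face opposite [X i] shares that whole face. Matching the
    three vertices gives an isometry between faces of [V], which [V_rigid] extends to a symmetry;
    that symmetry is the labelling of the neighbour. *)
Lemma tile_mirror X i : tile X ->
  exists Y, [/\ tile Y, forall m, m != i -> Y m = X m & Y i <> X i].
Proof.
move=> [f [s [Ff XV Xf]]].
have fnd := image_nondegenerate V_nd F_iso Ff.
have [e [g ffV]] := bary_frame_exists fnd.
have [h [Fh hf hx]] := neighbour_copy V_nd F_iso F_cover F_disj (s i) Ff.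
set x := \sum_m _ in hx; pose b m : R := if m == s i then 0 else 3^-1.
have b1 : \sum_m b m = 1 by exact: third_sum.
have fx : (f @` tetrahedron V) x.
  rewrite /tetrahedron hull_image; last exact: F_iso.
  exists b; split=> // [m|m]; last by rewrite inE.
  by rewrite /b; case: ifP => // _; rewrite invr_ge0.
have [] := F_face Ff Fh (fun fh => hf (esym fh)).
  by move=> S0; have : ((f @` tetrahedron V) `&` (h @` tetrahedron V)) x by []; rewrite S0.
move=> [k /andP[_ k3] [[J Jk SJ] [J' Jk' SJ']]].
have hullJ : f @` hull V J = h @` hull V J' by rewrite -SJ -SJ'.
(* The barycentre has positive weight at each vertex of its face, so the common face contains all of
   them. *)
have Jface m : m != s i -> m \in J.
  move=> mi; have : (f @` hull V J) x by rewrite -SJ.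
  rewrite hull_image; last exact: F_iso.
  case=> w [w0 wJ w1 xE]; apply/negPn/negP => /wJ wm.
  have := frame_coord (X := f \o V) ffV m b1; rewrite -/x xE (frame_coord (X := f \o V) ffV) // wm.
  by rewrite /b (negbTE mi) => /eqP; rewrite eq_sym invr_eq0 pnatr_eq0.
have [i' i'J] : exists i', i' \notin J'.
  apply: contrapT => nJ; have : J' = [set: 'I_4]%SET.
    by apply/setP => n; rewrite inE; apply/negPn/negP => nJ'; apply: nJ; exists n.
  by move=> JT; move: k3; rewrite -Jk' JT cardsT card_ord.
have vert m : m != i -> exists2 n, n \in J' & X m = h (V n).
  move=> mi; rewrite Xf; apply: (@shared_vertex (f \o V) (h \o V) J' (s m)) => //.
    rewrite -hull_image; last exact: F_iso.
    rewrite -hullJ; exists (V (s m)) => //; exists (fun n => (n == s m)%:R); split.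
    - by move=> n; exact: ler0n.
    - by move=> n nJ; case: eqP => // nm; move: nJ; rewrite nm Jface // (inj_eq perm_inj).
    - by rewrite (bigD1 (s m)) //= eqxx big1 ?addr0 // => n /negbTE ->.
    - by rewrite (bigD1 (s m)) //= eqxx scale1r big1 ?addr0 // => n /negbTE ->; rewrite scale0r.
  move=> n nJ; rewrite /tetrahedron -hull_image; last exact: F_iso.
  suff : (f @` hull V J) (h (V n)).
    case=> y [w [w0 _ w1 yE]] yh; exists y; last exact: yh.
    by exists w; split=> // l; rewrite inE.
  rewrite hullJ; exists (V n) => //; exists (fun l => (l == n)%:R); split.
  - by move=> l; exact: ler0n.
  - by move=> l lJ; case: eqP => // ln; move: lJ; rewrite ln nJ.
  - by rewrite (bigD1 n) //= eqxx big1 ?addr0 // => l /negbTE ->.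
  - by rewrite (bigD1 n) //= eqxx scale1r big1 ?addr0 // => l /negbTE ->; rewrite scale0r.
have /choice[t0 ht0] m : exists n, m != i -> n \in J' /\ X m = h (V n).
  by have [->|/vert[n nJ Xn]] := eqVneq m i; [exists i | exists n].
(* The vertex [i] is matched with a vertex [i'] of the neighbour off the common face. *)
pose t m := if m == i then i' else t0 m.
have Xinj : injective X.
  apply: nondegenerate_inj; apply: congruent_nondegenerate V_nd => m n.
  exact/esym/XV.
have tinj : injective t.
  move=> m n; rewrite /t; have [->|mi] := eqVneq m i; have [->|ni] := eqVneq n i => //.
  - by move=> ti; have [+ _] := ht0 n ni; rewrite -ti (negbTE i'J).
  - by move=> ti; have [+ _] := ht0 m mi; rewrite ti (negbTE i'J).
  - move=> tmn; have [_ Xm] := ht0 m mi; have [_ Xn] := ht0 n ni.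
    by apply: Xinj; rewrite Xm Xn tmn.
pose p := perm tinj.
have pX m : m != i -> h (V (p m)) = X m.
  by move=> mi; rewrite permE /t (negbTE mi); have [_ ->] := ht0 m mi.
have hsqd m n : sqd (h (V m)) (h (V n)) = sqd (V m) (V n).
  exact/eucl_dist_inj/(F_iso Fh).
have Vp : forall m n, sqd (V (p m)) (V (p n)) = sqd (V m) (V n).
  by apply: (V_rigid (i := i)) => m n mi ni; rewrite -hsqd !pX // XV.
exists (fun m => h (V (p m))); split=> //.
  by exists h, p; split=> // m n; rewrite hsqd Vp.
(* With all four vertices equal, the centroids of the two copies would coincide, hence the
   copies. *)
move=> hXi; apply: hf; apply/esym.
have q0 (m : 'I_4) : 0 < 4^-1 :> R by rewrite invr_gt0.
apply: (tile_same_copy (s := s) (t := p) Ff Fh q0 q0 (quarter_sum) (quarter_sum)).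
apply: eq_bigr => m _; rewrite -Xf; congr (_ *: _).
by have [->|mi] := eqVneq m i; rewrite ?hXi ?pX.
Qed.

Lemma rigid_no_tiling : False.
Proof.
have [X tX] : exists X, tile X.
  have : [set: 'rV[R]_3] 0 by [].
  rewrite -F_cover => -[f Ff _]; exists (f \o V), f, 1%g; split=> // [|i].
    by move=> i j; apply/eucl_dist_inj/(F_iso Ff).
  by rewrite perm1.
have [e [g fX]] : exists e g, bary_frame X e g.
  apply: bary_frame_exists; apply: congruent_nondegenerate V_nd => m n.
  exact/esym/(tile_congruent tX).
have X_scalene i j k : uniq [:: i; j; k] -> sqd (X i) (X k) != sqd (X j) (X k).
  by rewrite !(tile_congruent tX); exact: V_scalene.
pose x i := Num.sqrt (dot (g i) (g i)).
have x2 i : x i ^+ 2 = dot (g i) (g i) by rewrite sqr_sqrtr // dot_ge0.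
have x0 i : 0 < x i by rewrite sqrtr_gt0; exact: (frame_grad_gt0 fX).
pose c i j := - dot (g i) (g j) / (x i * x j).
apply: (@no_coxeter_scalene R x c) => //.
- by move=> i j; rewrite /c dotC mulrC (mulrC (x j)) mulrC.
- move=> i j ij.
  have [n n2] := dihedral_angle V_nd V_scalene tile_congruent tile_mirror tile_overlap tX fX ij.
  by rewrite /c => ->; exact: coxeter_cosineP.
- move=> i j k l us; rewrite /c.
  (* Pairing the vanishing sum of the gradients with [g i] and dividing by [x i] gives the
     relation. *)
  have : dot (g i) (\sum_m g m) = 0 by rewrite (frame_grad_sum fX) dot0r.
  rewrite (ord4_sum _ us) !dotDr -x2 => h.
  apply: (mulfI (lt0r_neq0 (x0 i))).
  transitivity (- dot (g i) (g j) - dot (g i) (g k) - dot (g i) (g l)); first by rewrite -expr2; lra.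
  by field; rewrite !lt0r_neq0.
- move=> i j k us; apply/eqP => eq_jk.
  have [l us4] := ord4_rcons us isT.
  (* The compared quantities are squared inverse heights in the face opposite [X i]; their equality
     would make two edges at [X l] equal. *)
  have fgE m : x m ^+ 2 * (1 - c i m ^+ 2) = dot (g m) (face_grad g i m).
    by rewrite dot_face_grad -!x2 /c; field; rewrite !lt0r_neq0.
  have := face_grad_edge fX us4; rewrite -!fgE eq_jk => /mulfI h.
  have ik : i != k by move: us; rewrite /= !inE negb_or => /andP[/andP[]].
  have : uniq [:: j; k; l] by move: us4 => /= /andP[].
  move/X_scalene/eqP; apply; apply: h.
  by rewrite fgE lt0r_neq0 // (face_grad_gt0 fX ik).
Qed.

End Rigid.

(** * Edge length patterns *)

Section Patterns.
Context {R : realType}.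
Implicit Types (V X : 'I_4 -> 'rV[R]_3).

Definition scalene V : Prop := forall i j k, uniq [:: i; j; k] ->
  sqd (V i) (V k) != sqd (V j) (V k).

Definition rigid V : Prop := forall (s : 'S_4) i,
  (forall m n, m != i -> n != i -> sqd (V (s m)) (V (s n)) = sqd (V m) (V n)) ->
  forall m n, sqd (V (s m)) (V (s n)) = sqd (V m) (V n).

Lemma scalene_perm V (s : 'S_4) : scalene (V \o s) -> scalene V.
Proof.
move=> sV i j k us.
have : uniq [seq (s^-1)%g m | m <- [:: i; j; k]] by rewrite (map_inj_uniq perm_inj).
by move/sV; rewrite /= !permKV.
Qed.

Lemma rigid_perm V (s : 'S_4) : rigid (V \o s) -> rigid V.
Proof.
move=> rV t i h m n; have := rV (s * t * s^-1)%g ((s^-1)%g i) _ ((s^-1)%g m) ((s^-1)%g n).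
rewrite /= !permM !permKV; apply=> m' n' mi ni; rewrite !permM !permKV h //.
  by apply: contra mi => /eqP <-; rewrite permK.
by apply: contra ni => /eqP <-; rewrite permK.
Qed.

(* Position of the edge joining [i] and [j] in [edge_lengths]; the value 6, for
   [i = j], is a dummy. *)
Definition edge_index (i j : nat) : nat :=
  nth 0%N (nth [::] [:: [:: 6; 0; 1; 2]; [:: 0; 6; 3; 4]; [:: 1; 3; 6; 5]; [:: 2; 4; 5; 6]]%N i) j.

Definition label (pat : seq nat) (i j : nat) : nat := nth 0%N pat (edge_index i j).

Definition scalene_pattern (pat : seq nat) : bool :=
  all (fun i => all (fun j => all (fun k =>
    uniq [:: i; j; k] ==> (label pat i k != label pat j k))
  (iota 0 4)) (iota 0 4)) (iota 0 4).

Definition same_label (pat t : seq nat) (m n : nat) : bool :=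
  (m != n) ==> (label pat (nth 0%N t m) (nth 0%N t n) == label pat m n).

Definition rigid_pattern (pat : seq nat) : bool :=
  all (fun t => all (fun i =>
    all (fun m => all (fun n =>
      (m != i) ==> (n != i) ==> same_label pat t m n) (iota 0 4)) (iota 0 4)
    ==> all (fun m => all (same_label pat t m) (iota 0 4)) (iota 0 4))
  (iota 0 4)) (permutations (iota 0 4)).

Lemma edge_lengthsE X (i j : 'I_4) : i != j ->
  eucl_dist (X i) (X j) = nth 0 (edge_lengths X) (edge_index i j).
Proof.
have o (m : 'I_4) : [\/ m = 0, m = 1, m = 2 | m = 3].
  by case: m => [[|[|[|[|m]]]] hm] //; [apply: Or41|apply: Or42|apply: Or43|apply: Or44]; apply: val_inj.
by case: (o i) => ->; case: (o j) => -> // _; rewrite !eucl_dist_sqd sqdC -?eucl_dist_sqd.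
Qed.

Lemma iota_ord (i : 'I_4) : (i : nat) \in iota 0 4.
Proof. by rewrite mem_iota ltn_ord. Qed.

Lemma perm_mem_permutations (s : 'S_4) :
  [seq (s m : nat) | m <- enum 'I_4] \in permutations (iota 0 4).
Proof.
rewrite mem_permutations -val_enum_ord.
rewrite (map_comp val s) perm_map // uniq_perm ?(map_inj_uniq perm_inj) ?enum_uniq //.
move=> m; rewrite mem_enum; apply/mapP; exists ((s^-1)%g m); first by rewrite mem_enum.
by rewrite permKV.
Qed.

(** As [L] has no repetition, lengths agree exactly when their labels do, so both properties become
    finite checks on the pattern, over all 24 permutations for rigidity. *)
Lemma pattern_scalene_rigid X (L : seq R) (pat : seq nat) :
  uniq L -> edge_lengths X = [seq nth 0 L n | n <- pat] ->
  size pat = 6 -> all (fun n => (n < size L)%N) pat ->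
  scalene_pattern pat -> rigid_pattern pat -> scalene X /\ rigid X.
Proof.
move=> uL XL s6 patL sp rp.
have idx (i j : 'I_4) : i != j -> (edge_index i j < 6)%N.
  by case: i j => [[|[|[|[|i]]]] hi] [[|[|[|[|j]]]] hj].
have lab (i j : 'I_4) : i != j -> (label pat i j < size L)%N.
  by move=> ij; rewrite (allP patL) // mem_nth // s6 idx.
have distE (i j : 'I_4) : i != j -> eucl_dist (X i) (X j) = nth 0 L (label pat i j).
  by move=> ij; rewrite edge_lengthsE // XL (nth_map 0%N) // s6 idx.
have eqE (i j m n : 'I_4) : i != j -> m != n ->
    (sqd (X i) (X j) == sqd (X m) (X n)) = (label pat i j == label pat m n).
  move=> ij mn; rewrite -(nth_uniq 0 (lab i j ij) (lab m n mn) uL) -!distE //.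
  apply/eqP/eqP => [h|]; first by rewrite !eucl_dist_sqd h.
  exact: eucl_dist_inj.
split.
- move=> i j k us.
  have := us; rewrite /= !inE negb_or => /and3P[/andP[_ ik] jk _].
  rewrite eqE //; move/allP/(_ _ (iota_ord i))/allP/(_ _ (iota_ord j)): sp.
  move=> /allP/(_ _ (iota_ord k))/implyP; apply.
  by rewrite -(map_inj_uniq (@ord_inj 4)) in us.
- move=> s i h m n; have [->|mn] := eqVneq m n.
    by apply/eqP; rewrite /sqd !subrr.
  have nths (l : 'I_4) : nth 0%N [seq (s m : nat) | m <- enum 'I_4] l = s l.
    by rewrite (nth_map ord0) ?size_enum_ord // nth_ord_enum.
  set t := map _ _ in nths; move/allP/(_ t (perm_mem_permutations s)): rp.
  move=> /allP/(_ _ (iota_ord i))/implyP rp.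
  have sameE (a b : 'I_4) : same_label pat t a b =
      (a != b) ==> (sqd (X (s a)) (X (s b)) == sqd (X a) (X b)).
    rewrite /same_label !nths; have [->|ab] := eqVneq a b; first by rewrite eqxx.
    by rewrite eqE ?(inj_eq perm_inj) // (inj_eq val_inj) ab.
  apply/eqP; have : same_label pat t m n; last by rewrite sameE mn.
  apply: (allP (allP (rp _) _ (iota_ord m)) _ (iota_ord n)).
  apply/allP => a; rewrite mem_iota => /andP[_ a4].
  apply/allP => b; rewrite mem_iota => /andP[_ b4].
  apply/implyP => ai; apply/implyP => bi.
  rewrite (sameE (Ordinal a4) (Ordinal b4)); apply/implyP => ab.
  by rewrite h.
Qed.

Lemma types_scalene_rigid V : type_g V \/ type_p V \/ type_w V \/ type_y V ->
  scalene V /\ rigid V.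
Proof.
have perm (s : 'S_4) : scalene (V \o s) /\ rigid (V \o s) -> scalene V /\ rigid V.
  by case=> /scalene_perm ? /rigid_perm ?.
move=> [[s [a [b [c [uL VL]]]]]|[[s [a [b [c [d [uL VL]]]]]]|[]]].
- by apply: (perm s); apply: (pattern_scalene_rigid (pat := [:: 0; 1; 2; 2; 1; 0]%N) uL VL); vm_compute.
- by apply: (perm s); apply: (pattern_scalene_rigid (pat := [:: 0; 2; 1; 1; 3; 0]%N) uL VL); vm_compute.
- move=> [s [a [b [c [d [e [uL VL]]]]]]].
  by apply: (perm s); apply: (pattern_scalene_rigid (pat := [:: 1; 0; 2; 3; 0; 4]%N) uL VL); vm_compute.
- move=> [s [a [b [c [d [e [f [uL VL]]]]]]]].
  by apply: (perm s); apply: (pattern_scalene_rigid (pat := [:: 0; 1; 2; 3; 4; 5]%N) uL VL); vm_compute.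
Qed.

End Patterns.

Theorem theorem6p6 (R : realType) (V : 'I_4 -> 'rV[R]_3) :
  nondegenerate_tetrahedron V ->
  type_g V \/ type_p V \/ type_w V \/ type_y V ->
  ~ tiles_face_to_face V.
Proof.
move=> V_nd /types_scalene_rigid[V_scalene V_rigid] [F [F_iso F_cover F_disj F_face]].
exact: rigid_no_tiling V_nd F_iso F_cover F_disj F_face V_scalene V_rigid.
Qed.
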